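(* If $\Gamma$ is a circular $k$-gon and $p\in\mathbb{N}$, there are constants $c_\star(p),M_\star,h_\star>0$ such that (a) $\#\Pi(p,q)\ge c_\star(p)\,q^{kp-1}+\mathrm{O}(q^{kp-2})$ as $q\to\infty$ for any fixed $p\in\mathbb{N}$; and (b) $\#\Pi(q)\ge M_\star e^{h_\star q}/q$ as $q\to+\infty$ (that is, for all sufficiently large $q$). (The constants $M_\star$ and $h_\star$ do not depend on $p$.)
   Context: **Circular polygons.** A circular $k$-gon is a simple closed strictly convex curve $\Gamma\subset\mathbb{R}^2\simeq\mathbb{C}$ formed by the concatenation of $k>1$ circular arcs $\Gamma_1,\dots,\Gamma_k$ (listed counter-clockwise, index modulo $k$) that is $C^1$ but not $C^2$ at the intersection point (node) of any two consecutive arcs; so consecutive arcs have different radii, and circles are excluded. The arc $\Gamma_j$ has center $O_j$, radius $r_j>0$ and angular range $[a_j,b_j]$, with $b_j=a_{j+1}$ and $a_1<b_1=a_2<\cdots<b_k=a_1+2\pi$. The polar parametrisation is $z:\mathbb{T}=\mathbb{R}/2\pi\mathbb{Z}\to\Gamma$, $z(\varphi)=O_j+r_je^{i\varphi}$ for $\varphi\in[a_j,b_j]$. **Billiard map.** For $0<\theta<\pi$, the line through $z(\varphi)$ in the direction $v$ obtained by rotating $z'(\varphi)$ counter-clockwise by $\theta$ meets $\Gamma$ at exactly one other point $z(\bar\varphi)$; $\bar\theta\in(0,\pi)$ is the counter-clockwise angle from $v$ to $z'(\bar\varphi)$, and $f(\varphi,\theta)=(\bar\varphi,\bar\theta)$,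 a homeomorphism of $\mathbb{T}\times(0,\pi)$. **Periodic trajectories.** For integers $1\le p<q$, $\Pi(p,q)$ is the set of $(p,q)$-periodic billiard trajectories in $\Gamma$: the periodic trajectories (orbits of $f$ in $\mathbb{T}\times(0,\pi)$) that close after $q$ impacts and $p$ turns around $\Gamma$, i.e. $f^q(x)=x$ and, lifting the impact angles to $\mathbb{R}$ so that $\varphi_{n+1}\in(\varphi_n,\varphi_n+2\pi)$, one has $\varphi_q=\varphi_0+2\pi p$ (rotation number $p/q$). The minimal period may be smaller than $q$ when $\gcd(p,q)\ne1$. $\Pi(q)=\bigcup_{1\le p<q}\Pi(p,q)$. The symbol $\#$ denotes cardinality (possibly infinite). *)

(* Defs.v *)
(* The plane is R[i], for an arbitrary R : realType. *)
From HB Require Import structures.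
From mathcomp Require Import all_boot all_order all_algebra.
From mathcomp Require Import complex.
From mathcomp Require Import all_classical all_reals all_analysis.

Set Implicit Arguments.
Unset Strict Implicit.
Unset Printing Implicit Defensive.

Import Order.TTheory GRing.Theory Num.Theory.
Import numFieldNormedType.Exports.

Local Open Scope classical_set_scope.
Local Open Scope ring_scope.
Local Open Scope complex_scope.

Section Definitions.
Variable R : realType.

Definition cis (t : R) : R[i] := cos t +i* sin t.

(* Arcs are indexed counter-clockwise by 'I_k, cyclically through ordS.
   The outgoing tangent of arc j at the angle phi is i * cis phi, so abutting
   angular ranges (arc_next, arc_wrap) make the curve C^1 at the nodes; the
   curvature is 1 / radius j on arc j, so it is not C^2 at a node exactly when
   the two radii differ (radius_next).  By polar_arc and polar_period,
   consecutive arcs, including the last and the first, share their endpoint. *)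
Record circular_polygon (k : nat) := CircularPolygon {
  center : 'I_k -> R[i];
  radius : 'I_k -> R;
  arc_start : 'I_k -> R;
  arc_end : 'I_k -> R;
  polar : R -> R[i];
  card_arcs : (1 < k)%N;
  radius_gt0 : forall j, 0 < radius j;
  arc_lt : forall j, arc_start j < arc_end j;
  arc_next : forall i j : 'I_k, j = i.+1 :> nat -> arc_end i = arc_start j;
  arc_wrap : forall i j : 'I_k, i = 0%N :> nat -> j = k.-1 :> nat ->
    arc_end j = arc_start i + 2 * pi;
  radius_next : forall j, radius (ordS j) != radius j;
  polar_period : forall phi, polar (phi + 2 * pi) = polar phi;
  polar_arc : forall j phi, arc_start j <= phi <= arc_end j ->
    polar phi = center j + (radius j)%:C * cis phi;
  polar_simple : forall phi psi, 0 <= phi < 2 * pi -> 0 <= psi < 2 * pi ->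
    polar phi = polar psi -> phi = psi;
  (* strict convexity: an open chord does not meet the curve *)
  polar_strictly_convex : forall phi psi chi t,
    polar phi != polar psi -> 0 < t < 1 ->
    polar chi != (1 - t)%:C * polar phi + t%:C * polar psi
}.

Section Billiard.
Variables (k : nat) (G : circular_polygon k).

(* Unit vector along z'(phi); at a node, where z' jumps in length, it is the
   common direction of the two one-sided derivatives. *)
Definition tangent (phi : R) : R[i] := (0 +i* 1) * cis phi.

(* One impact, with angles in R and the next angle lifted to
   (phi, phi + 2 pi). *)
Definition reflects (x y : R * R) : Prop :=
  let v := tangent x.1 * cis x.2 in
  [/\ x.1 < y.1 < x.1 + 2 * pi,
      exists t : R, polar G y.1 = polar G x.1 + t%:C * v,
      0 < y.2 < pi
    & tangent y.1 = v * cis y.2].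

(* Only meaningful for x.2 in (0, pi), where the image is unique. *)
Definition billiard_lift (x : R * R) : R * R := xget x [set y | reflects x y].

(* The circle R / 2 pi Z is represented by [0, 2 pi). *)
Definition angle_mod (phi : R) : R :=
  phi - (Num.floor (phi / (2 * pi)))%:~R * (2 * pi).

Definition phase_space : set (R * R) :=
  [set x | 0 <= x.1 < 2 * pi /\ 0 < x.2 < pi].

Definition billiard_map (x : R * R) : R * R :=
  let y := billiard_lift x in (angle_mod y.1, y.2).

(* For a periodic point the forward orbit is the whole orbit. *)
Definition billiard_orbit (x : R * R) : set (R * R) :=
  range (fun n : nat => iter n billiard_map x).

Definition periodic_trajectories (p q : nat) : set (set (R * R)) :=
  [set T | exists x, [/\ phase_space x,
     iter q billiard_map x = x,
     (iter q billiard_lift x).1 = x.1 + 2 * pi * p%:R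
   & T = billiard_orbit x]].

Definition all_periodic_trajectories (q : nat) : set (set (R * R)) :=
  \bigcup_(p in [set p | (1 <= p < q)%N]) periodic_trajectories p q.

End Billiard.
End Definitions.

(* Main.v *)
(* Trajectories sliding along the boundary are built by maximizing length.  On an
   arc the impacts are equally spaced, so a closed polygon with prescribed numbers
   of impacts on the successive arcs is described by the two half-steps (y, x)
   next to each node: y before it and x after it.  If the sliding angles decrease
   slightly into an arc of larger radius and increase slightly into an arc of
   smaller radius, the length gradient points into a suitable small box of
   parameters on each of its faces.  The maximum over the product of the boxes is
   then interior, hence a billiard trajectory.  The angles h (1 - eps r_j) have
   this property and are consistent around the curve, so every sequence of
   impact numbers within c/h of the proportional one is realized.  Over p turns
   with q impacts, h is of order p/q.  This leaves about q^(kp-1) sequences for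
   fixed p, and at least 2^(kp-1) when p is a small fixed proportion of q.  An
   orbit determines its sequence up to a rotation by t < p turns, and dividing
   by p only changes the constants. *)
Require Import Defs.
From mathcomp Require Import all_boot all_order all_algebra.
From mathcomp Require Import complex finmap ring lra zify.
From mathcomp Require Import all_classical all_reals all_analysis.

Set Implicit Arguments.
Unset Strict Implicit.
Unset Printing Implicit Defensive.

Import Order.TTheory GRing.Theory Num.Theory.
Import numFieldNormedType.Exports.

Local Open Scope classical_set_scope.
Local Open Scope ring_scope.

(** * Sine bounds *)

Section Trig.
Context {R : realType}.
Implicit Types x y : R.

Lemma sin_le_id x : 0 <= x -> sin x <= x.
Proof.
rewrite le_eqVlt => /predU1P[<-|x0]; first by rewrite sin0.
have [c _] : exists2 c, c \in `]0, x[%R & sin x - sin 0 = cos c * (x - 0).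
  apply: (@MVT _ sin cos) => //.
  by apply: continuous_subspaceT => z; exact: continuous_sin.
rewrite sin0 !subr0 => ->.
by rewrite ler_piMl ?cos_le1// ltW.
Qed.

(** The slope of [sin] at the intermediate point is [cos c = 1 - 2 * sin (c / 2) ^+ 2], which is at
    least [1 - c ^+ 2 / 2]. *)
Lemma sin_ge_cubic x : 0 <= x -> x * (1 - x ^+ 2 / 2) <= sin x.
Proof.
rewrite le_eqVlt => /predU1P[<-|x0]; first by rewrite sin0 mul0r.
have [c] : exists2 c, c \in `]0, x[%R & sin x - sin 0 = cos c * (x - 0).
  apply: (@MVT _ sin cos) => //.
  by apply: continuous_subspaceT => z; exact: continuous_sin.
rewrite sin0 !subr0 in_itv/= => /andP[c0 cx] ->.
rewrite mulrC ler_pM2r//.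
have -> : cos c = 1 - 2 * sin (c / 2) ^+ 2.
  by rewrite [in LHS](splitr c) cosD -!expr2 cos2sin2; ring.
have s0 : `|sin (c / 2)| <= c / 2.
  rewrite ler_norml sin_le_id ?andbT; last by lra.
  have := @sin_ge0_pi R; have := @sin_geN1 R (c / 2) => h1 h2.
  case: (ltP c 2) => c2; last by lra.
  suff : 0 <= sin (c / 2) by lra.
  by apply: h2; have := @pi_ge2 R; lra.
have : sin (c / 2) ^+ 2 <= (c / 2) ^+ 2.
  by rewrite -real_normK ?num_real//; have := normr_ge0 (sin (c / 2)); nra.
have : c ^+ 2 <= x ^+ 2 by nra.
nra.
Qed.

End Trig.

(** * Maxima with inward gradient *)

Section BoxMax.
Context {R : realType}.
Implicit Types (f : R -> R) (x y : R).

Lemma is_derive_gt0_right f x d : is_derive x 1 f d -> 0 < d ->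
  forall e, 0 < e -> exists2 y, x < y < x + e & f x < f y.
Proof.
move=> [df <-] d0 e e0.
have df' : (fun h => h^-1 *: (f (h *: 1 + x) - f x)) @ 0^' --> 'D_1 f x by exact: df.
have : \forall h \near 0^', 0 < h^-1 *: (f (h *: 1 + x) - f x).
  exact: (cvgr_gt _ df').
move=> -[/= del del0 H].
pose h := Num.min (e / 2) (del / 2).
have h0 : 0 < h by rewrite lt_min; apply/andP; split; lra.
have he : h <= e / 2 by rewrite ge_min lexx.
have hd : h <= del / 2 by rewrite ge_min lexx orbT.
exists (x + h); first by lra.
have := H h; rewrite /= sub0r normrN gtr0_norm// => /(_ _ (lt0r_neq0 h0)) H1.
have : 0 < h^-1 * (f (h * 1 + x) - f x) by apply: H1; lra.
by rewrite pmulr_rgt0 ?invr_gt0// subr_gt0 mulr1 addrC.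
Qed.

Lemma is_derive_lt0_left f x d : is_derive x 1 f d -> d < 0 ->
  forall e, 0 < e -> exists2 y, x - e < y < x & f x < f y.
Proof.
move=> df d0 e e0.
have df' : is_derive (- x) 1 (f \o -%R) (- d).
  have -> : - d = d * (- 1) by ring.
  by apply: is_derive1_comp; rewrite opprK.
have [|y] := is_derive_gt0_right df' _ e0; first by lra.
move=> yx; rewrite /= opprK => fxy; exists (- y) => //; lra.
Qed.

(** The signs of the slope at [a] and [b] exclude a maximum at the ends; at an interior maximum both
    one-sided comparisons apply. *)
Lemma box_max_interior f (d : R -> R) a b y : a <= y <= b ->
  (forall z, a <= z <= b -> is_derive z 1 f (d z)) ->
  (forall z, a <= z <= b -> f z <= f y) -> a < b ->
  0 < d a -> d b < 0 -> a < y < b /\ d y = 0.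
Proof.
move=> /andP[ay yb] df fmax ab da db.
have nright : y < b -> d y <= 0.
  move=> ltyb; rewrite leNgt; apply/negP => dy.
  have [||z zy] := is_derive_gt0_right (df y _) dy (e := b - y); rewrite ?ay//.
    lra.
  by rewrite ltNge fmax//; lra.
have nleft : a < y -> 0 <= d y.
  move=> ltya; rewrite leNgt; apply/negP => dy.
  have [||z zy] := is_derive_lt0_left (df y _) dy (e := y - a); rewrite ?ay//.
    lra.
  by rewrite ltNge fmax//; lra.
have ltay : a < y.
  rewrite lt_neqAle ay andbT; apply/eqP => eay; subst y.
  by have := nright ab; lra.
have ltyb : y < b.
  rewrite lt_neqAle yb andbT; apply/eqP => eay; subst y.
  by have := nleft ab; lra.
by split; [lra | have := nright ltyb; have := nleft ltay; lra].
Qed.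

End BoxMax.

(** * Chords across a node *)

Section Chord.
Context {R : realType}.
Implicit Types r x y t a b : R.

(** Length of the chord that subtends the angle [x] on a circle of radius [r]. *)
Definition arm r x : R := 2 * r * sin (x / 2).

(** Tangential and inward normal components, at the impact at angle [y] before a node, of the vector
    to the impact at angle [x] after it; it is the sum of two chords meeting at the node. Exchanging
    the arcs gives the view from the other end. *)
Definition dirX r y r' x : R := arm r' x * cos (x / 2 + y) + arm r y * cos (y / 2).
Definition dirY r y r' x : R := arm r' x * sin (x / 2 + y) + arm r y * sin (y / 2).

(** Law of cosines: the direction turns by [(x + y) / 2] between the two chords meeting at the
    node. *)
Definition chord2 r y r' x : R :=
  arm r y ^+ 2 + arm r' x ^+ 2 + 2 * arm r y * arm r' x * cos ((x + y) / 2).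

Definition chord r y r' x : R := Num.sqrt (chord2 r y r' x).

Lemma chordC r y r' x : chord r y r' x = chord r' x r y.
Proof. by rewrite /chord; congr Num.sqrt; rewrite /chord2 (addrC y x); ring. Qed.

Lemma chord2E r y r' x :
  chord2 r y r' x = dirX r y r' x ^+ 2 + dirY r y r' x ^+ 2.
Proof.
rewrite /chord2 /dirX /dirY.
have -> : (x + y) / 2 = (x / 2 + y) - y / 2 by field.
rewrite cosB.
move: (cos2Dsin2 (x / 2 + y)) (cos2Dsin2 (y / 2)).
set c := cos (x / 2 + y); set s := sin (x / 2 + y); set c' := cos _; set s' := sin _.
move=> e1 e2.
transitivity (arm r y ^+ 2 * (c' ^+ 2 + s' ^+ 2) + arm r' x ^+ 2 * (c ^+ 2 + s ^+ 2)
  + 2 * arm r y * arm r' x * (c * c' + s * s')); last by ring.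
by rewrite e1 e2 !mulr1.
Qed.

Lemma chord_gt0 r y r' x : 0 < dirY r y r' x -> 0 < chord r y r' x.
Proof. by move=> V0; rewrite sqrtr_gt0 chord2E; nra. Qed.

Lemma chord_sqr r y r' x :
  chord r y r' x ^+ 2 = dirX r y r' x ^+ 2 + dirY r y r' x ^+ 2.
Proof. by rewrite sqr_sqrtr chord2E// addr_ge0// sqr_ge0. Qed.

Lemma chord_small_gt0 r y r' x : 0 < r -> 0 < r' -> 0 < y <= 1 / 2 ->
  0 < x <= 1 / 2 -> 0 < chord r y r' x.
Proof.
move=> r0 r'0 y0 x0; have pi2 := @pi_ge2 R.
have s1 : 0 < sin (x / 2) by apply: sin_gt0_pi; lra.
have s2 : 0 < sin (y / 2) by apply: sin_gt0_pi; lra.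
have s3 : 0 < sin (x / 2 + y) by apply: sin_gt0_pi; lra.
by apply: chord_gt0; rewrite /dirY /arm addr_gt0// !mulr_gt0.
Qed.

Lemma is_derive_sin_affine a b x :
  is_derive x 1 (fun z : R => sin (a + b * z)) (b * cos (a + b * x)).
Proof.
have -> : (fun z : R => sin (a + b * z)) = sin \o (fun z => a + b * z) by [].
rewrite mulrC; apply: is_derive1_comp.
apply: is_derive_eq; rewrite /GRing.scale/=. ring.
Qed.

Lemma is_derive_cos_affine a b x :
  is_derive x 1 (fun z : R => cos (a + b * z)) (- (b * sin (a + b * x))).
Proof.
have -> : (fun z : R => cos (a + b * z)) = cos \o (fun z => a + b * z) by [].
rewrite mulrC -mulNr; apply: is_derive1_comp.
apply: is_derive_eq; rewrite /GRing.scale/=. ring.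
Qed.

Lemma is_derive_chord2 r y r' x :
  is_derive y 1 (fun z => chord2 r z r' x) (2 * r * dirX r y r' x).
Proof.
have -> : (fun z => chord2 r z r' x) =
   (fun z => (2 * r * sin (0 + 2^-1 * z)) * (2 * r * sin (0 + 2^-1 * z)) + arm r' x ^+ 2
     + 2 * arm r' x * (2 * r * sin (0 + 2^-1 * z) * cos (x / 2 + 2^-1 * z))).
  apply/funext => z; rewrite /chord2 /arm add0r (mulrC 2^-1 z).
  by have -> : (x + z) / 2 = x / 2 + z / 2 by [field]; ring.
have ds := is_derive_sin_affine 0 2^-1 y.
have dc := is_derive_cos_affine (x / 2) 2^-1 y.
apply: is_derive_eq; rewrite /GRing.scale/= !add0r /dirX /arm.
have -> : cos (x / 2 + y) = cos ((x / 2 + 2^-1 * y) + y / 2) by congr cos; field.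
rewrite (cosD (x / 2 + 2^-1 * y)) (mulrC 2^-1 y); by field.
Qed.

(** First variation of length: increasing [y] moves the endpoint backwards along its tangent with
    speed [r], so the length grows at the rate [r] times the cosine of the chord's angle. *)
Lemma is_derive_chord r y r' x : 0 < dirY r y r' x ->
  is_derive y 1 (fun z => chord r z r' x) (r * dirX r y r' x / chord r y r' x).
Proof.
move=> V0; have K0 := chord_gt0 V0.
have -> : (fun z => chord r z r' x) = Num.sqrt \o (fun z => chord2 r z r' x) by [].
have -> : r * dirX r y r' x / chord r y r' x =
  (2 * Num.sqrt (chord2 r y r' x))^-1 * (2 * r * dirX r y r' x).
  rewrite -/(chord r y r' x); field; exact: lt0r_neq0.
apply: is_derive1_comp; last exact: is_derive_chord2.
by apply: is_derive1_sqrt; rewrite -sqrtr_gt0.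
Qed.

End Chord.

(** * Maximality in a single half-step *)

Section CoordinateMax.
Context {R : realType}.
Implicit Types r x y t a b : R.

Lemma cos_sin_of_projection (X Y K t : R) : 0 < K -> 0 < Y -> 0 < t < pi / 2 ->
  K ^+ 2 = X ^+ 2 + Y ^+ 2 -> X = K * cos t -> Y = K * sin t.
Proof.
move=> K0 Y0 t0 eK eX; have s0 := sin_gt0_pihalf t0.
have : Y ^+ 2 = (K * sin t) ^+ 2.
  by rewrite exprMn sin2cos2 mulrBr mulr1 -exprMn -eX eK; ring.
by move/eqP; rewrite eqrXn2 ?mulr_ge0 ?(ltW K0) ?(ltW Y0) ?(ltW s0)// => /eqP.
Qed.

(** If [(X, Y)] has length [K] and angle [s], the cross product is [K * sin (s - t)], so its sign
    compares [s] with [t] and hence their cosines. Comparing squares avoids introducing [s]. *)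
Lemma projection_gt (X Y K t : R) : 0 < K -> 0 < Y -> 0 < t < pi / 2 ->
  K ^+ 2 = X ^+ 2 + Y ^+ 2 -> Y * cos t - X * sin t < 0 -> K * cos t < X.
Proof.
move=> K0 Y0 t0 eK XY; have s0 := sin_gt0_pihalf t0.
have c0 : 0 < cos t by apply: cos_gt0_pihalf; have := @pi_gt0 R; lra.
have X0 : 0 < X by have := mulr_gt0 Y0 c0; nra.
rewrite -(ltr_pXn2r (n := 2)) ?nnegrE ?mulr_ge0 ?ltW//.
rewrite exprMn eK; have := cos2Dsin2 t; move: XY s0 c0.
set c := cos t; set s := sin t => XY s0 c0 cs.
have : (Y * c) ^+ 2 < (X * s) ^+ 2.
  by rewrite ltr_pXn2r ?nnegrE ?mulr_ge0 ?ltW//; lra.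
rewrite !exprMn; have -> : s ^+ 2 = 1 - c ^+ 2 by lra.
nra.
Qed.

Lemma projection_lt (X Y K t : R) : 0 < K -> 0 < Y -> 0 < t < pi / 2 ->
  K ^+ 2 = X ^+ 2 + Y ^+ 2 -> 0 < Y * cos t - X * sin t -> X < K * cos t.
Proof.
move=> K0 Y0 t0 eK XY; have s0 := sin_gt0_pihalf t0.
have c0 : 0 < cos t by apply: cos_gt0_pihalf; have := @pi_gt0 R; lra.
case: (leP X 0) => X0; first by have := mulr_gt0 K0 c0; lra.
rewrite -(ltr_pXn2r (n := 2)) ?nnegrE ?mulr_ge0 ?ltW//.
rewrite exprMn eK; have := cos2Dsin2 t; move: XY s0 c0.
set c := cos t; set s := sin t => XY s0 c0 cs.
have : (X * s) ^+ 2 < (Y * c) ^+ 2.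
  by rewrite ltr_pXn2r ?nnegrE ?mulr_ge0 ?ltW//; lra.
rewrite !exprMn; have -> : s ^+ 2 = 1 - c ^+ 2 by lra.
nra.
Qed.

Lemma dir_cross r y r' x t : dirY r y r' x * cos t - dirX r y r' x * sin t =
  arm r' x * sin (x / 2 + y - t) + arm r y * sin (y / 2 - t).
Proof. by rewrite /dirY /dirX !sinB; ring. Qed.

(** The function is the total length of [N] equal chords on a circle of radius [r] that together
    span the angle [s - z]. *)
Lemma is_derive_arc_length r (N s z : R) : 0 < N ->
  is_derive z 1 (fun z : R => 2 * r * N * sin ((s - z) / (2 * N)))
    (- (r * cos ((s - z) / (2 * N)))).
Proof.
move=> N0; have N0' := lt0r_neq0 N0.
have e (w : R) : (s - w) / (2 * N) = s / (2 * N) + (- (2 * N)^-1) * w.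
  by field.
have -> : (fun z : R => 2 * r * N * sin ((s - z) / (2 * N))) =
  (fun z : R => (2 * r * N) * sin (s / (2 * N) + (- (2 * N)^-1) * z)).
  by apply/funext => w; rewrite e.
have ds := is_derive_sin_affine (s / (2 * N)) (- (2 * N)^-1) z.
by apply: is_derive_eq; rewrite /GRing.scale/= e; field.
Qed.

(* The derivative of the length in y is r * (cos of the angle of the crossing
   chord - cos of the angle on the arc), so the two sign conditions say that
   the gradient points into the box. *)
Lemma coordinate_max r (N s : R) r' x a b y :
  let t (z : R) := (s - z) / (2 * N) in
  0 < r -> 0 < N -> a < b -> a <= y <= b ->
  (forall z, a <= z <= b -> 0 < t z < pi / 2) ->
  (forall z, a <= z <= b -> 0 < dirY r z r' x) ->
  arm r' x * sin (x / 2 + a - t a) + arm r a * sin (a / 2 - t a) < 0 ->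
  0 < arm r' x * sin (x / 2 + b - t b) + arm r b * sin (b / 2 - t b) ->
  (forall z, a <= z <= b ->
    chord r z r' x + 2 * r * N * sin (t z) <=
    chord r y r' x + 2 * r * N * sin (t y)) ->
  [/\ a < y < b, dirX r y r' x = chord r y r' x * cos (t y) &
      dirY r y r' x = chord r y r' x * sin (t y)].
Proof.
move=> t r0 N0 ab yab ht hY fa fb fmax.
pose d z := r * dirX r z r' x / chord r z r' x - r * cos (t z).
have dE z : a <= z <= b ->
    d z = r / chord r z r' x * (dirX r z r' x - chord r z r' x * cos (t z)).
  move=> zab; have K0 := lt0r_neq0 (chord_gt0 (hY z zab)).
  by rewrite /d; field.
have df z : a <= z <= b ->
    is_derive z 1 (fun z => chord r z r' x + 2 * r * N * sin (t z)) (d z).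
  move=> zab; apply: is_deriveD; first by apply: is_derive_chord; exact: hY.
  exact: is_derive_arc_length.
have a_in : a <= a <= b by lra.
have b_in : a <= b <= b by lra.
have pos z : a <= z <= b -> 0 < r / chord r z r' x.
  by move=> zab; rewrite divr_gt0// chord_gt0// hY.
have [||aby dy] := box_max_interior yab df fmax ab.
- rewrite dE// pmulr_rgt0 ?pos// subr_gt0.
  apply: projection_gt (ht a a_in) (chord_sqr _ _ _ _) _; rewrite ?dir_cross//.
    exact/chord_gt0/hY.
  exact: hY.
- rewrite dE// pmulr_rlt0 ?pos// subr_lt0.
  apply: projection_lt (ht b b_in) (chord_sqr _ _ _ _) _; rewrite ?dir_cross//.
    exact/chord_gt0/hY.
  exact: hY.
have eX : dirX r y r' x = chord r y r' x * cos (t y).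
  move/eqP: dy; rewrite dE// mulf_eq0 gt_eqF ?pos//= subr_eq0.
  by move/eqP.
split => //.
apply: cos_sin_of_projection (ht y yab) (chord_sqr _ _ _ _) eX; last exact: hY.
exact/chord_gt0/hY.
Qed.

End CoordinateMax.

(** * Inward gradient on a box of half-steps at a node *)

Section CrossingMax.
Context {R : realType}.
Implicit Types r p m h eta : R.

(* The angles on the two arcs are within [m] of [h - p] and [h - p'], where
   [p] and [p'] are proportional to the radii [r < r']. *)
Record crossing_scale r r' p p' m h eta : Prop := CrossingScale {
  scale_r : 0 < r;
  scale_r' : 0 < r';
  scale_p : 0 < p;
  scale_m : 0 <= m;
  scale_mp : 4 * m <= p' - p;
  scale_lt : p < p';
  scale_p' : 8 * p' <= h;
  scale_h : 0 < h <= 1 / 8;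
  scale_eta : 0 < eta < 1;
  scale_sin : forall t : R, 0 <= t <= 4 * h -> (1 - eta) * t <= sin t;
  scale_key :
    r * (2 * p') * h < r' * (1 - eta) ^+ 2 * (h - p - 2 * p') * (p + p' - m)
}.

Lemma crossing_dirY r r' p p' m h eta (y x : R) :
  crossing_scale r r' p p' m h eta ->
  0 <= y <= 4 * p' -> 2 * (h - p - 2 * p') <= x <= 2 * h ->
  0 < dirY r y r' x /\ 0 < dirY r' x r y.
Proof.
move=> [r0 r'0 p0 m0 mp m_lt p'h /andP[h0 h8] _ _ _] yb xb; rewrite /dirY /arm.
have pi2 := @pi_ge2 R.
have s1 : 0 < sin (x / 2) by apply: sin_gt0_pi; lra.
have s2 : 0 <= sin (y / 2) by apply: sin_ge0_pi; lra.
have s3 : 0 < sin (x / 2 + y) by apply: sin_gt0_pi; lra.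
have s4 : 0 < sin (y / 2 + x) by apply: sin_gt0_pi; lra.
have a1 := mulr_gt0 r'0 s1; have a2 := mulr_ge0 (ltW r0) s2.
split.
- have := mulr_gt0 a1 s3; have := mulr_ge0 a2 s2; lra.
- have := mulr_gt0 a1 s1; have := mulr_ge0 a2 (ltW s4); lra.
Qed.

(** The decisive hypothesis is [scale_key]. For weights proportional to the radii it holds to
    leading order because [2 * r * p' = 2 * r' * p < r' * (p + p')]. *)
Lemma crossing_compare r r' p p' m h eta (z b x a : R) :
  crossing_scale r r' p p' m h eta ->
  0 <= z <= 4 * p' -> 0 <= b <= h ->
  2 * (h - p - 2 * p') <= x <= 2 * h -> p + p' - m <= a <= 4 * h ->
  arm r z * sin b < arm r' x * sin a.
Proof.
move=> hs zb bb xb ab; have [r0 r'0 p0 m0 mp m_lt p'h /andP[h0 h8] eta01 sin_ge _] := hs; rewrite /arm.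
have pi2 := @pi_ge2 R.
have s1 : (1 - eta) * (h - p - 2 * p') <= sin (x / 2).
  have H : 0 <= x / 2 <= 4 * h by lra.
  by apply: le_trans (sin_ge _ H); rewrite ler_pM2l; lra.
have s2 : (1 - eta) * (p + p' - m) <= sin a.
  have H : 0 <= a <= 4 * h by lra.
  by apply: le_trans (sin_ge _ H); rewrite ler_pM2l; lra.
have s3 : sin (z / 2) <= 2 * p' by apply: le_trans (sin_le_id _) _; lra.
have s4 : sin b <= h by apply: le_trans (sin_le_id _) _; lra.
have s5 : 0 <= sin (z / 2) by apply: sin_ge0_pi; lra.
have s6 : 0 <= sin b by apply: sin_ge0_pi; lra.
have H1 : sin (z / 2) * sin b <= 2 * p' * h by apply: ler_pM.
have H2 : ((1 - eta) * (h - p - 2 * p')) * ((1 - eta) * (p + p' - m)) <=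
   sin (x / 2) * sin a.
  by apply: ler_pM => //; apply: mulr_ge0; lra.
have H3 : r * (sin (z / 2) * sin b) <= r * (2 * p' * h) by rewrite ler_pM2l.
have H4 : r' * (((1 - eta) * (h - p - 2 * p')) * ((1 - eta) * (p + p' - m))) <=
   r' * (sin (x / 2) * sin a) by rewrite ler_pM2l.
have : 2 * (r * (sin (z / 2) * sin b)) < 2 * (r' * (sin (x / 2) * sin a)).
  rewrite ltr_pM2l//; apply: le_lt_trans H3 _; apply: lt_le_trans H4.
  by have := scale_key hs; lra.
lra.
Qed.

Lemma crossing_max r r' p p' m h eta (N s N' s' y x : R) :
  crossing_scale r r' p p' m h eta ->
  let t (z : R) := (s - z) / (2 * N) in let t' (z : R) := (s' - z) / (2 * N') in
  0 < N -> 0 < N' ->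
  (forall z, 0 <= z <= 4 * p' -> h - p - m <= t z <= h - p + m) ->
  (forall z, 2 * (h - p - 2 * p') <= z <= 2 * h - p - p' ->
     h - p' - m <= t' z <= h - p' + m) ->
  0 <= y <= 4 * p' -> 2 * (h - p - 2 * p') <= x <= 2 * h - p - p' ->
  (forall z, 0 <= z <= 4 * p' ->
    chord r z r' x + 2 * r * N * sin (t z) <=
    chord r y r' x + 2 * r * N * sin (t y)) ->
  (forall z, 2 * (h - p - 2 * p') <= z <= 2 * h - p - p' ->
    chord r' z r y + 2 * r' * N' * sin (t' z) <=
    chord r' x r y + 2 * r' * N' * sin (t' x)) ->
  [/\ 0 < y, dirX r y r' x = chord r y r' x * cos (t y) &
      dirY r y r' x = chord r y r' x * sin (t y)] /\
  [/\ 0 < x, dirX r' x r y = chord r' x r y * cos (t' x) &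
      dirY r' x r y = chord r' x r y * sin (t' x)].
Proof.
move=> hs; have [r0 r'0 p0 m0 mp m_lt p'h /andP[h0 h8] _ _ _] := hs;
move=> t t' N0 N'0 ht ht' yb xb ymax xmax; have pi2 := @pi_ge2 R.
have xb' : 2 * (h - p - 2 * p') <= x <= 2 * h by lra.
split.
- have [|||||yab eX eY] := coordinate_max (y := y) r0 N0 _ yb _ _ _ _ ymax.
  + lra.
  + move=> z /ht; rewrite -/(t z); lra.
  + by move=> z zb; have [] := crossing_dirY hs zb xb'.
  (* At [y = 0] the chord stays on the second arc, with angle [x / 2 <= h - (p + p') / 2]; this is
     below [h - p - m] because [4 * m <= p' - p]. *)
  + rewrite -/(t 0) {2}/arm mul0r sin0 mulr0 mul0r !addr0.
    have t0 : h - p - m <= t 0 <= h - p + m by apply: ht; lra.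
    have s1 : 0 < sin (x / 2) by apply: sin_gt0_pi; lra.
    have s2 : 0 < sin (t 0 - x / 2) by apply: sin_gt0_pi; lra.
    rewrite -[x / 2 - t 0]opprB sinN mulrN oppr_lt0 /arm.
    by rewrite !mulr_gt0.
  (* Here [x / 2 + 4 * p' - t] is at least [2 * p' - m], above the threshold [p + p' - m] of
     [crossing_compare]. *)
  + rewrite -/(t (4 * p')).
    have t0 : h - p - m <= t (4 * p') <= h - p + m by apply: ht; lra.
    rewrite -[4 * p' / 2 - _]opprB sinN mulrN subr_gt0.
    apply: (crossing_compare hs); lra.
  + by split => //; lra.
- have [|||||xab eX eY] := coordinate_max (y := x) r'0 N'0 _ xb _ _ _ _ xmax.
  + lra.
  + move=> z /ht'; rewrite -/(t' z); lra.
  + move=> z zb; have zb' : 2 * (h - p - 2 * p') <= z <= 2 * h by lra.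
    by have [] := crossing_dirY hs yb zb'.
  (* The lower end is chosen so that [t' - X1 / 2] is at least the threshold [p + p' - m]. *)
  + set X1 := 2 * (h - p - 2 * p'); rewrite -/(t' X1).
    have t0 : h - p' - m <= t' X1 <= h - p' + m by apply: ht'; rewrite /X1; lra.
    rewrite -[X1 / 2 - _]opprB sinN mulrN subr_lt0.
    apply: (crossing_compare hs); rewrite /X1 in t0 *; lra.
  (* At the upper end [X2 / 2] exceeds [h - p' + m], so neither term is negative. *)
  + set X2 := 2 * h - p - p'; rewrite -/(t' X2).
    have t0 : h - p' - m <= t' X2 <= h - p' + m by apply: ht'; rewrite /X2; lra.
    rewrite /X2 in t0 *; apply: ltr_wpDl.
      rewrite /arm; apply: mulr_ge0; last by apply: sin_ge0_pi; lra.
      by apply: mulr_ge0; [lra | apply: sin_ge0_pi; lra].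
    rewrite /arm; apply: mulr_gt0; last by apply: sin_gt0_pi; lra.
    by apply: mulr_gt0; [lra | apply: sin_gt0_pi; lra].
  + by split => //; lra.
Qed.

End CrossingMax.

(** * Reflection *)

Section Crossing.
Context {R : realType}.
Implicit Types r p m h eta y x : R.

(** Box for a half-step on the arc of weight [p] whose neighbour has weight [p']: short steps on the
    arc of smaller weight, steps close to [2 * h] on the other. *)
Definition box_lo h p p' : R := if p < p' then 0 else 2 * (h - p' - 2 * p).
Definition box_hi h p p' : R := if p < p' then 4 * p' else 2 * h - p - p'.

Definition crossing_scales r r' p p' m h eta :=
  (p < p' /\ crossing_scale r r' p p' m h eta) \/
  (p' < p /\ crossing_scale r' r p' p m h eta).

(* Time reversal exchanges the two arcs, which reduces to [r < r']. *)
Lemma crossing_boxes_max r r' p p' m h eta (N s N' s' y x : R) :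
  let t (z : R) := (s - z) / (2 * N) in let t' (z : R) := (s' - z) / (2 * N') in
  crossing_scales r r' p p' m h eta ->
  0 < N -> 0 < N' ->
  (forall z, box_lo h p p' <= z <= box_hi h p p' -> h - p - m <= t z <= h - p + m) ->
  (forall z, box_lo h p' p <= z <= box_hi h p' p ->
     h - p' - m <= t' z <= h - p' + m) ->
  box_lo h p p' <= y <= box_hi h p p' -> box_lo h p' p <= x <= box_hi h p' p ->
  (forall z, box_lo h p p' <= z <= box_hi h p p' ->
    chord r z r' x + 2 * r * N * sin (t z) <=
    chord r y r' x + 2 * r * N * sin (t y)) ->
  (forall z, box_lo h p' p <= z <= box_hi h p' p ->
    chord r y r' z + 2 * r' * N' * sin (t' z) <=
    chord r y r' x + 2 * r' * N' * sin (t' x)) ->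
  [/\ 0 < y, dirX r y r' x = chord r y r' x * cos (t y) &
      dirY r y r' x = chord r y r' x * sin (t y)] /\
  [/\ 0 < x, dirX r' x r y = chord r y r' x * cos (t' x) &
      dirY r' x r y = chord r y r' x * sin (t' x)].
Proof.
move=> t t' [] [pp hs] N0 N'0 ht ht' yb xb ymax xmax.
- have np : p' < p = false by apply/negbTE; rewrite -leNgt ltW.
  rewrite /box_lo /box_hi pp np [2 * h - p' - p]addrAC in ht ht' yb xb ymax xmax.
  have := crossing_max hs N0 N'0 ht ht' yb xb ymax; rewrite (chordC r' x r y).
  by apply=> z zb; rewrite (chordC r' z r y) xmax.
- have np : p < p' = false by apply/negbTE; rewrite -leNgt ltW.
  rewrite /box_lo /box_hi pp np [2 * h - p - p']addrAC in ht ht' yb xb ymax xmax.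
  rewrite and_comm.
  have := crossing_max hs N'0 N0 ht' ht xb yb; rewrite (chordC r' x r y).
  by apply=> z zb; rewrite ?(chordC r' z r y) ?xmax ?ymax.
Qed.

End Crossing.

Section Reflect.
Context {R : realType}.
Local Open Scope complex_scope.

Lemma eq_parts (z w : R[i]) :
  complex.Re z = complex.Re w -> complex.Im z = complex.Im w -> z = w.
Proof. by case: z w => [? ?] [? ?] /= -> ->. Qed.

Lemma cisD (a b : R) : cis (a + b) = cis a * cis b.
Proof. by apply: eq_parts; rewrite /= ?cosD ?sinD; ring. Qed.

Lemma cis2pi : cis (2 * pi) = 1 :> R[i].
Proof.
have -> : 2 * pi = pi *+ 2 :> R by rewrite mulr_natl.
by apply: eq_parts; rewrite /= ?cos2pi ?sin2pi.
Qed.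

(** A chord of the unit circle is parallel to the tangent at the middle of its arc. *)
Lemma cis_chord (u v : R) :
  cis (u + v) - cis (u - v) = (2 * sin v)%:C * ((0 +i* 1) * cis u).
Proof. by apply: eq_parts; rewrite /= ?cosD ?sinD ?cosN ?sinN; ring. Qed.

Variables (k : nat) (G : circular_polygon R k).

Lemma reflects_arc (O : R[i]) (r phi t : R) :
  polar G phi = O + r%:C * cis phi ->
  polar G (phi + 2 * t) = O + r%:C * cis (phi + 2 * t) ->
  0 < t < pi -> reflects G (phi, t) (phi + 2 * t, t).
Proof.
move=> e1 e2 t0; split => /=; first by lra.
- exists (2 * r * sin t); rewrite /= e1 e2 /tangent.
  have g : phi + t + t = phi + 2 * t by ring.
  have f := cis_chord (phi + t) t; rewrite addrK g in f.
  rewrite -(mulrA (0 +i* 1)) -cisD -[cis (phi + 2 * t)](subrK (cis phi)) f.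
  by rewrite mulrDr !rmorphM/=; ring.
- exact: t0.
- by rewrite /tangent -!mulrA -!cisD; congr (_ * cis _); ring.
Qed.

(** The equations for [dirX] and [dirY] describe one chord in the tangent frames at its two ends;
    comparing the frames gives the arrival angle. *)
Lemma reflects_node (O O' : R[i]) (r r' b y x t t' : R) :
  O + r%:C * cis b = O' + r'%:C * cis b ->
  polar G (b - y) = O + r%:C * cis (b - y) ->
  polar G (b + x) = O' + r'%:C * cis (b + x) ->
  0 < y -> 0 < x -> x + y < 2 * pi -> 0 < t < pi -> 0 < t' < pi ->
  0 < chord r y r' x ->
  dirX r y r' x = chord r y r' x * cos t ->
  dirY r y r' x = chord r y r' x * sin t ->
  dirX r' x r y = chord r y r' x * cos t' ->
  dirY r' x r y = chord r y r' x * sin t' ->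
  reflects G (b - y, t) (b + x, t').
Proof.
set K := chord r y r' x.
move=> eb e1 e2 y0 x0 xy t0 t'0 K0 eX eY eX' eY'.
have D1 : (arm r' x)%:C * cis (x / 2 + y) + (arm r y)%:C * cis (y / 2) =
    K%:C * cis t.
  by apply: eq_parts => /=; move: eX eY; rewrite /dirX /dirY; lra.
have D2 : (arm r y)%:C * cis (y / 2 + x) + (arm r' x)%:C * cis (x / 2) =
    K%:C * cis t'.
  by apply: eq_parts => /=; move: eX' eY'; rewrite /dirX /dirY; lra.
(* The chord is split at the node, which lies on both circles. *)
have D : polar G (b + x) - polar G (b - y) =
    tangent (b - y) * ((arm r' x)%:C * cis (x / 2 + y) + (arm r y)%:C * cis (y / 2)).
  have f1 := cis_chord (b + x / 2) (x / 2).
  have f2 := cis_chord (b - y / 2) (y / 2).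
  have g1 : b + x / 2 + x / 2 = b + x by field.
  have g2 : b + x / 2 - x / 2 = b by field.
  have g3 : b - y / 2 + y / 2 = b by field.
  have g4 : b - y / 2 - y / 2 = b - y by field.
  rewrite g1 g2 in f1; rewrite g3 g4 in f2.
  rewrite e1 e2 mulrDr /tangent !(mulrCA _ (_%:C)) -!(mulrA (0 +i* 1)) -!cisD.
  have -> : b - y + (x / 2 + y) = b + x / 2 by ring.
  have -> : b - y + y / 2 = b - y / 2 by field.
  have -> : O' = O + r%:C * cis b - r'%:C * cis b by rewrite eb addrK.
  transitivity (r'%:C * (cis (b + x) - cis b) + r%:C * (cis b - cis (b - y))).
    ring.
  by rewrite f1 f2 /arm !rmorphM/=; ring.
split => /=.
- lra.
- exists K; rewrite -[LHS](subrK (polar G (b - y))) D D1 addrC; congr (_ + _).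
  by rewrite mulrCA.
- exact: t'0.
have C0 : K%:C != 0 :> R[i] by rewrite eq_complex /= eqxx andbT lt0r_neq0.
(* The tangent turns by [x + y] from one impact to the other, and the two chord angles add up to
   this turn. *)
have e : cis (t + t') = cis (x + y) :> R[i].
  have rev (z : R) : cis z * cis (- z) = 1 :> R[i].
    by rewrite -cisD subrr /cis cos0 sin0.
  (* Both chord directions describe the same vector, seen from the two ends. *)
  have E1 : K%:C * (cis t * cis (- y)) =
     (arm r' x)%:C * cis (x / 2) + (arm r y)%:C * cis (- (y / 2)).
    rewrite mulrA -D1 mulrDl -!mulrA -!cisD.
    by congr (_ * cis _ + _ * cis _); field.
  have E2 : K%:C * (cis (- t') * cis x) =
     (arm r' x)%:C * cis (x / 2) + (arm r y)%:C * cis (- (y / 2)).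
    have conj : K%:C * cis (- t') =
        (arm r y)%:C * cis (- (y / 2 + x)) + (arm r' x)%:C * cis (- (x / 2)).
      move: D2; rewrite /cis !sinN !cosN => /eqP; rewrite eq_complex/= => /andP[/eqP h1 /eqP h2].
      by apply: eq_parts => /=; lra.
    rewrite mulrA conj mulrDl -!mulrA -!cisD addrC.
    by congr (_ * cis _ + _ * cis _); field.
  have := mulfI C0 (etrans E1 (esym E2)) => E.
  have := congr1 (fun z => z * (cis y * cis t')) E.
  rewrite !cisD -(mulrA (cis t)) [cis (- y) * _]mulrA [cis (- y) * _]mulrC rev mul1r => ->.
  rewrite mulrACA [_ * cis t']mulrC; move: (rev t') => rt.
  rewrite mulrACA [cis (- t') * _]mulrC rt; ring.
have -> : b + x = (b - y) + (x + y) by ring.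
by rewrite /tangent (cisD (b - y)) -e (cisD t); ring.
Qed.

End Reflect.

(** * Uniqueness of the reflection, and orbits of lifted sequences *)

Section Orbits.
Context {R : realType}.
Local Open Scope complex_scope.
Variables (k : nat) (G : circular_polygon R k).

Lemma twopi_gt0 : 0 < 2 * pi :> R.
Proof. by have := @pi_gt0 R; lra. Qed.

Lemma twopi_neq0 : 2 * pi != 0 :> R.
Proof. exact: lt0r_neq0 twopi_gt0. Qed.

Lemma polar_shift (phi : R) (n : int) : polar G (phi + n%:~R * (2 * pi)) = polar G phi.
Proof.
have nat_shift (m : nat) psi : polar G (psi + m%:R * (2 * pi)) = polar G psi.
  elim: m => [|m IH]; first by rewrite mul0r addr0.
  by rewrite -natr1 mulrDl mul1r addrA polar_period.
case: n => m; first by rewrite -pmulrn nat_shift.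
rewrite NegzE mulrNz mulNr -[LHS](nat_shift m.+1) -pmulrn.
by congr polar; ring.
Qed.

Lemma cis_shift (t : R) (n : int) : cis (t + n%:~R * (2 * pi)) = cis t.
Proof.
have nat_shift (m : nat) psi : cis (psi + m%:R * (2 * pi)) = cis psi :> R[i].
  elim: m => [|m IH]; first by rewrite mul0r addr0.
  by rewrite -natr1 mulrDl mul1r addrA cisD cis2pi mulr1.
case: n => m; first by rewrite -pmulrn nat_shift.
rewrite NegzE mulrNz mulNr -[LHS](nat_shift m.+1) -pmulrn.
by congr cis; ring.
Qed.

Lemma angle_mod_itv (phi : R) : 0 <= angle_mod phi < 2 * pi.
Proof.
rewrite /angle_mod; set n := Num.floor _.
have t0 := twopi_gt0.
have := floor_le (phi / (2 * pi)); have := floorD1_gt (phi / (2 * pi)).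
rewrite -/n ler_pdivlMr// ltr_pdivrMr// rmorphD/= mulrDl; lra.
Qed.

Lemma angle_modE (phi : R) : exists n : int, angle_mod phi = phi + n%:~R * (2 * pi).
Proof.
exists (- Num.floor (phi / (2 * pi))); rewrite /angle_mod rmorphN/=; ring.
Qed.

Lemma angle_mod_shift (phi : R) (n : int) : angle_mod (phi + n%:~R * (2 * pi)) = angle_mod phi.
Proof.
have t0 := twopi_neq0.
rewrite /angle_mod; have -> : (phi + n%:~R * (2 * pi)) / (2 * pi) = phi / (2 * pi) + n%:~R.
  by rewrite mulrDl mulfK.
rewrite floorDrz ?intr_int// intrKfloor rmorphD/=; ring.
Qed.

Lemma angle_mod_inj (phi psi : R) : angle_mod phi = angle_mod psi ->
  exists n : int, psi = phi + n%:~R * (2 * pi).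
Proof.
have [n ->] := angle_modE phi; have [m ->] := angle_modE psi => e.
exists (n - m); rewrite rmorphB/= mulrBl; lra.
Qed.

Lemma polar_inj (a phi psi : R) : a <= phi < a + 2 * pi -> a <= psi < a + 2 * pi ->
  polar G phi = polar G psi -> phi = psi.
Proof.
move=> phia psia e.
have e' : polar G (angle_mod phi) = polar G (angle_mod psi).
  have [n ->] := angle_modE phi; have [m ->] := angle_modE psi.
  by rewrite !polar_shift.
have := polar_simple (angle_mod_itv phi) (angle_mod_itv psi) e'.
move/angle_mod_inj => [n en]; rewrite en in psia *.
have t0 := twopi_gt0.
have : `|n%:~R * (2 * pi)| < 2 * pi :> R by rewrite ltr_norml; lra.
rewrite normrM (gtr0_norm t0) -ltr_pdivlMr// divff ?twopi_neq0// -intr_norm ltrz1.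
move=> n1; have -> : n = 0 by lia.
by rewrite mul0r addr0.
Qed.

Lemma no_three_collinear (v Q : R[i]) (phi psi chi a b c : R) : v != 0 ->
  polar G phi = Q + a%:C * v -> polar G chi = Q + b%:C * v ->
  polar G psi = Q + c%:C * v -> a < b -> b < c -> False.
Proof.
move=> v0 e1 e2 e3 ab bc.
have ac : c - a != 0 by apply: lt0r_neq0; lra.
pose s := (b - a) / (c - a).
have eb : b = (1 - s) * a + s * c by rewrite /s; field.
have := @polar_strictly_convex _ _ G phi psi chi s.
rewrite e1 e2 e3 {1}eb; move=> /(_ _ _)/negP; apply.
- apply/eqP => /addrI/(mulIf v0)/eqP; rewrite eq_complex/= => /andP[/eqP]; lra.
- by rewrite /s divr_gt0 ?ltr_pdivrMr ?mul1r; lra.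
- by apply/eqP; move: (s) => u; rewrite rmorphD/= !rmorphM/= rmorphB/=; ring.
Qed.

(** Two different next impacts would put three points of the curve on a line; each order of the
    three is excluded. The angle in (0, pi) is then determined by its cosine. *)
Lemma reflects_uniq (x y y' : R * R) : reflects G x y -> reflects G x y' -> y = y'.
Proof.
case: x y y' => [f t] [f1 t1] [f2 t2] [/= h1 [s1 e1] t10 d1] [/= h2 [s2 e2] t20 d2].
set v := tangent f * cis t in e1 e2 d1 d2.
have pf : polar G f = polar G f + 0%:C * v by rewrite mul0r addr0.
have n1 : polar G f1 != polar G f.
  by apply/eqP => /(@polar_inj f); have := twopi_gt0; move=> ? /(_ _ _) ?; lra.
have n2 : polar G f2 != polar G f.
  by apply/eqP => /(@polar_inj f); have := twopi_gt0; move=> ? /(_ _ _) ?; lra.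
have v0 : v != 0 by apply: contraNneq n1 => v0; rewrite e1 v0 mulr0 addr0.
have s10 : s1 != 0 by apply: contraNneq n1 => s0; rewrite e1 s0 mul0r addr0.
have s20 : s2 != 0 by apply: contraNneq n2 => s0; rewrite e2 s0 mul0r addr0.
have es : s1 = s2.
  have N := @no_three_collinear v (polar G f).
  case: (ltgtP s1 s2) => // s12; exfalso.
  - case: (ltgtP s1 0) s10 => // s10 _; last exact: N v0 pf e1 e2 s10 s12.
    case: (ltgtP s2 0) s20 => // s20 _; first exact: N v0 e1 e2 pf s12 s20.
    exact: N v0 e1 pf e2 s10 s20.
  - case: (ltgtP s2 0) s20 => // s20 _; last exact: N v0 pf e2 e1 s20 s12.
    case: (ltgtP s1 0) s10 => // s10 _; first exact: N v0 e2 e1 pf s12 s10.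
    exact: N v0 e2 pf e1 s20 s10.
have ef : f1 = f2 by apply: (@polar_inj f); [lra | lra | rewrite e1 e2 es].
subst f2; congr (_, _); apply: (@cos_inj R); rewrite ?in_itv/=; [lra|lra|].
have : v * cis t1 = v * cis t2 by rewrite -d1 -d2.
by move/(mulfI v0)/eqP; rewrite eq_complex/= => /andP[/eqP].
Qed.

Lemma billiard_lift_eq (x y : R * R) : reflects G x y -> billiard_lift G x = y.
Proof. by move=> xy; apply: xget_unique => // z /reflects_uniq; exact. Qed.

Lemma reflects_shift (x y : R * R) (n : int) : reflects G x y ->
  reflects G (x.1 + n%:~R * (2 * pi), x.2) (y.1 + n%:~R * (2 * pi), y.2).
Proof.
case=> h [s e] t d; split => /=.
- lra.
- by exists s; rewrite !polar_shift e /tangent cis_shift.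
- exact: t.
- by rewrite /tangent !cis_shift.
Qed.

Definition phase_point (x : R * R) : R * R := (angle_mod x.1, x.2).

Section Sequence.
Variable F : nat -> R * R.
Hypothesis F_reflects : forall n, reflects G (F n) (F n.+1).

Lemma iter_billiard_lift (c : int) m n :
  iter n (billiard_lift G) ((F m).1 + c%:~R * (2 * pi), (F m).2) =
  ((F (n + m)).1 + c%:~R * (2 * pi), (F (n + m)).2).
Proof.
elim: n => //= n ->; exact/billiard_lift_eq/reflects_shift.
Qed.

Lemma iter_billiard_map n :
  iter n (billiard_map G) (phase_point (F 0%N)) = phase_point (F n).
Proof.
elim: n => //= n ->; rewrite /billiard_map /phase_point.
have [c ec] := angle_modE (F n).1.
by rewrite ec (billiard_lift_eq (reflects_shift c (F_reflects n)))/= angle_mod_shift.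
Qed.

Lemma periodic_trajectory_of_sequence p q : (forall n, 0 < (F n).2 < pi) ->
  F q = ((F 0%N).1 + 2 * pi * p%:R, (F 0%N).2) ->
  periodic_trajectories G p q (billiard_orbit G (phase_point (F 0%N))).
Proof.
move=> F2 Fq; exists (phase_point (F 0%N)); split => //.
- by split; [exact: angle_mod_itv | exact: F2].
- rewrite iter_billiard_map /phase_point Fq/=.
  by rewrite -[p%:R]/(p%:Z%:~R) mulrC angle_mod_shift.
- rewrite /phase_point; have [c ec] := angle_modE (F 0%N).1.
  by rewrite ec iter_billiard_lift addn0 Fq/=; ring.
Qed.

End Sequence.

(** The start of the second sequence lies on the orbit of the first up to full turns, and uniqueness
    of the reflection propagates this to all later impacts. *)
Lemma orbit_eq_shift (F F' : nat -> R * R) :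
  (forall n, reflects G (F n) (F n.+1)) -> (forall n, reflects G (F' n) (F' n.+1)) ->
  billiard_orbit G (phase_point (F 0%N)) = billiard_orbit G (phase_point (F' 0%N)) ->
  exists n (c : int), forall s,
    F' s = ((F (n + s)%N).1 + c%:~R * (2 * pi), (F (n + s)%N).2).
Proof.
move=> hF hF' e.
have : billiard_orbit G (phase_point (F 0%N)) (phase_point (F' 0%N)).
  by rewrite e; exists 0%N.
move=> [n _]; rewrite iter_billiard_map// => -[/angle_mod_inj[c ec] e2].
exists n, c; elim=> [|s IH]; first by rewrite addn0 e2 -ec; case: (F' 0%N).
rewrite -(billiard_lift_eq (hF' s)) IH.
by apply/billiard_lift_eq; rewrite addnS; exact/reflects_shift.
Qed.

End Orbits.

(** * Maximizing the length of a cyclic chain *)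

Section ChainMax.
Context {R : realType}.

Lemma box_argmax n (lo hi : 'I_n -> R) (L : 'rV[R]_n -> R) :
  (forall i, lo i <= hi i) -> continuous L ->
  exists2 v : 'rV[R]_n, (forall i, lo i <= v ord0 i <= hi i) &
    forall w : 'rV[R]_n, (forall i, lo i <= w ord0 i <= hi i) -> L w <= L v.
Proof.
move=> lohi cL.
pose A := [set v : 'rV[R]_n | forall i, `[lo i, hi i]%classic (v ord0 i)].
have cA : compact A.
  by apply: (@rV_compact _ _ (fun i => `[lo i, hi i]%classic)) => i; exact: segment_compact.
have A0 : A !=set0.
  by exists (\row_i lo i) => i /=; rewrite mxE in_itv/= lexx lohi.
have [v vA vmax] := EVT_max_rV A0 cA (continuous_subspaceT cL).
exists v => [i|w wA].
  by move: vA; rewrite inE => /(_ i)/=; rewrite in_itv.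
by apply: vmax; rewrite inE => i /=; rewrite in_itv/=; exact: wA.
Qed.

Lemma continuous_pair_coord n (f : R -> R -> R) (i j : 'I_n) :
  continuous (fun u : R * R => f u.1 u.2) ->
  continuous (fun v : 'rV[R]_n => f (v ord0 i) (v ord0 j)).
Proof.
move=> cf v.
have cpair : {for v, continuous (fun v : 'rV[R]_n => (v ord0 i, v ord0 j))}.
  exact: (cvg_pair (@coord_continuous R 1 n ord0 i v) (@coord_continuous R 1 n ord0 j v)).
exact: (continuous_comp cpair (cf _)).
Qed.

Lemma continuous_bigsum (T : topologicalType) (I : Type) (s : seq I) (F : I -> T -> R) :
  (forall i, continuous (F i)) -> continuous (fun v => \sum_(i <- s) F i v).
Proof.
move=> cF; elim: s => [|i s IH].
  have -> : (fun v => \sum_(i <- [::]) F i v) = (fun=> 0).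
    by apply/funext => v; rewrite big_nil.
  by move=> v; exact: cvg_cst.
have -> : (fun v => \sum_(i <- i :: s) F i v) = (fun v => F i v + \sum_(i <- s) F i v).
  by apply/funext => v; rewrite big_cons.
by move=> v; apply: cvgD; [exact: cF | exact: IH].
Qed.

(** [C i] stands for the length across a node, [A i] for the length along the arc between the
    preceding crossing and this one. Of the joint maximum only maximality in each coordinate is
    kept. *)
Lemma chain_argmax m (C A : 'I_m -> R -> R -> R) (ylo yhi xlo xhi : 'I_m -> R) :
  (forall i, continuous (fun u : R * R => C i u.1 u.2)) ->
  (forall i, continuous (fun u : R * R => A i u.1 u.2)) ->
  (forall i, ylo i <= yhi i) -> (forall i, xlo i <= xhi i) ->
  exists ys xs : 'I_m -> R,
    [/\ forall i, ylo i <= ys i <= yhi i, forall i, xlo i <= xs i <= xhi i,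
      forall i z, ylo i <= z <= yhi i ->
        C i z (xs i) + A i (xs (ord_pred i)) z <=
        C i (ys i) (xs i) + A i (xs (ord_pred i)) (ys i)
    & forall i z, xlo i <= z <= xhi i ->
        C i (ys i) z + A (ordS i) z (ys (ordS i)) <=
        C i (ys i) (xs i) + A (ordS i) (xs i) (ys (ordS i))].
Proof.
move=> cC cA ylohi xlohi.
pose Y (v : 'rV[R]_(m + m)) i := v ord0 (lshift m i).
pose X (v : 'rV[R]_(m + m)) i := v ord0 (rshift m i).
pose L v := \sum_(i < m) C i (Y v i) (X v i) + \sum_(i < m) A i (X v (ord_pred i)) (Y v i).
pose lo (i : 'I_(m + m)) := match fintype.split i with inl j => ylo j | inr j => xlo j end.
pose hi (i : 'I_(m + m)) := match fintype.split i with inl j => yhi j | inr j => xhi j end.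
have cL : continuous L.
  have c1 := @continuous_bigsum _ _ (index_enum 'I_m)
    (fun i v => C i (Y v i) (X v i)) (fun i => continuous_pair_coord (cC i)).
  have c2 := @continuous_bigsum _ _ (index_enum 'I_m)
    (fun i v => A i (X v (ord_pred i)) (Y v i)) (fun i => continuous_pair_coord (cA i)).
  by move=> v; exact: (cvgD (c1 v) (c2 v)).
have lohi i : lo i <= hi i by rewrite /lo /hi; case: (fintype.split i).
have [v vbox vmax] := box_argmax lohi cL.
have boxY (w : 'rV[R]_(m + m)) : (forall i, lo i <= w ord0 i <= hi i) <->
   (forall i, ylo i <= Y w i <= yhi i) /\ (forall i, xlo i <= X w i <= xhi i).
  split=> [h|[hy hx] i].
    split=> i.
      by have := h (lshift m i); rewrite /lo /hi (unsplitK (inl i)).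
    by have := h (rshift m i); rewrite /lo /hi (unsplitK (inr i)).
  rewrite /lo /hi; case: splitP => j ej.
    by have -> : i = lshift m j by [apply: val_inj]; exact: hy.
  by have -> : i = rshift m j by [apply: val_inj]; exact: hx.
have [hy hx] := (boxY v).1 vbox.
exists (Y v), (X v); split => // i z zb.
- pose w : 'rV[R]_(m + m) := \row_j if j == lshift m i then z else v ord0 j.
  have Xw j : X w j = X v j.
    by rewrite /X mxE; case: eqP => // /(congr1 val) /= e; have := ltn_ord i; lia.
  have Yw j : Y w j = if j == i then z else Y v j.
    by rewrite /Y mxE (inj_eq (@lshift_inj _ _)).
  have : (forall j, ylo j <= Y w j <= yhi j) /\ (forall j, xlo j <= X w j <= xhi j).
    by split=> j; rewrite ?Xw ?Yw//; case: eqP => // ->.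
  move=> /boxY/vmax; rewrite /L !(bigD1 i (P := predT))//= !Yw eqxx !Xw.
  rewrite (eq_bigr (fun j => C j (Y v j) (X v j))); last first.
    by move=> j ji; rewrite Yw (negbTE ji) Xw.
  rewrite [X in _ + (_ + X) <= _](eq_bigr (fun j => A j (X v (ord_pred j)) (Y v j))); last first.
    by move=> j ji; rewrite Yw (negbTE ji) Xw.
  lra.
- pose w : 'rV[R]_(m + m) := \row_j if j == rshift m i then z else v ord0 j.
  have Yw j : Y w j = Y v j.
    by rewrite /Y mxE; case: eqP => // /(congr1 val) /= e; have := ltn_ord j; lia.
  have Xw j : X w j = if j == i then z else X v j.
    by rewrite /X mxE (inj_eq (@rshift_inj _ _)).
  have : (forall j, ylo j <= Y w j <= yhi j) /\ (forall j, xlo j <= X w j <= xhi j).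
    by split=> j; rewrite ?Xw ?Yw//; case: eqP => // ->.
  (* The coordinate [xs i] enters [C i] and [A (ordS i)], so different indices are isolated in the
     two sums. *)
  move=> /boxY/vmax; rewrite /L (bigD1 i (P := predT))//= [X in _ + X <= _](bigD1 (ordS i))//=.
  rewrite [X in _ <= X + _](bigD1 i)//= [X in _ <= _ + X](bigD1 (ordS i))//=.
  rewrite !Yw !Xw !ordSK eqxx.
  rewrite (eq_bigr (fun j => C j (Y v j) (X v j))); last first.
    by move=> j ji; rewrite Xw (negbTE ji) Yw.
  rewrite [X in _ + (_ + X) <= _](eq_bigr (fun j => A j (X v (ord_pred j)) (Y v j))); last first.
    move=> j ji; rewrite Xw Yw; case: eqP => // e.
    by rewrite -e ord_predK eqxx in ji.
  lra.
Qed.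

Lemma continuous_sin_comp (f : R * R -> R) : continuous f -> continuous (sin \o f).
Proof. by move=> cf u; apply: continuous_comp; [exact: cf | exact: continuous_sin]. Qed.

Lemma continuous_chord (r r' : R) : continuous (fun u : R * R => chord r u.1 r' u.2).
Proof.
have c1 : continuous (fun u : R * R => u.1) by move=> u; exact: cvg_fst.
have c2 : continuous (fun u : R * R => u.2) by move=> u; exact: cvg_snd.
have carm (s : R) (f : R * R -> R) : continuous f -> continuous (fun u => arm s (f u)).
  move=> cf u; apply: cvgM; first exact: cvg_cst.
  apply: (continuous_sin_comp (f := fun u => f u / 2)) => {}u.
  by apply: cvgM; [exact: cf | exact: cvg_cst].
move=> u.
have c3 : continuous (fun u : R * R => chord2 r u.1 r' u.2).
  move=> {}u; rewrite /chord2; apply: cvgD; first apply: cvgD.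
  - by apply: cvgM; exact: carm.
  - by apply: cvgM; exact: carm.
  apply: cvgM; first apply: cvgM; first apply: cvgM.
  - exact: cvg_cst.
  - exact: carm.
  - exact: carm.
  apply: (continuous_comp (f := fun u : R * R => (u.2 + u.1) / 2)); last exact: continuous_cos.
  by apply: cvgM; [apply: cvgD; [exact: c2 | exact: c1] | exact: cvg_cst].
apply: (continuous_comp (f := fun u : R * R => chord2 r u.1 r' u.2)); first exact: c3.
exact: sqrt_continuous.
Qed.

Lemma continuous_arc_length (r N l : R) :
  continuous (fun u : R * R => 2 * r * N * sin ((l - u.1 - u.2) / (2 * N))).
Proof.
move=> u; apply: cvgM; first exact: cvg_cst.
apply: (continuous_sin_comp (f := fun u => (l - u.1 - u.2) / (2 * N))) => {}u.
apply: cvgM; last exact: cvg_cst.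
by apply: cvgB; [apply: cvgB; [exact: cvg_cst | exact: cvg_fst] | exact: cvg_snd].
Qed.

End ChainMax.

(** * Arcs lifted to the line *)

Section Lift.
Context {R : realType}.
Local Open Scope complex_scope.
Variables (k : nat) (G : circular_polygon R k).

Lemma arcs_gt0 : (0 < k)%N.
Proof. exact: ltnW (card_arcs G). Qed.

Definition arc (i : nat) : 'I_k := Ordinal (ltn_pmod i arcs_gt0).
Definition rad (i : nat) : R := Defs.radius G (arc i).
Definition cen (i : nat) : R[i] := Defs.center G (arc i).
Definition node (i : nat) : R := arc_start G (arc i) + (i %/ k)%:R * (2 * pi).
Definition len (i : nat) : R := node i.+1 - node i.

Lemma arcD i t : arc (i + t * k) = arc i.
Proof. by apply: val_inj; rewrite /= addnC modnMDl. Qed.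

Lemma radD i t : rad (i + t * k) = rad i.
Proof. by rewrite /rad arcD. Qed.

Lemma nodeD i t : node (i + t * k) = node i + t%:R * (2 * pi).
Proof. by rewrite /node arcD addnC divnMDl ?arcs_gt0 // natrD mulrDl; ring. Qed.

Lemma lenD i t : len (i + t * k) = len i.
Proof. by rewrite /len -addSn !nodeD; ring. Qed.

Lemma rad_gt0 i : 0 < rad i.
Proof. exact: radius_gt0. Qed.

Lemma nodeS i : node i.+1 = arc_end G (arc i) + (i %/ k)%:R * (2 * pi).
Proof.
have k0 := arcs_gt0; rewrite /node.
have ik : (i %% k < k)%N by rewrite ltn_pmod.
have ei := divn_eq i k.
case: (ltngtP (i %% k).+1 k) ik => // h _.
- have [e1 e2] : (i.+1 %/ k = i %/ k /\ i.+1 %% k = (i %% k).+1)%N.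
    have {1 2}-> : i.+1 = ((i %/ k) * k + (i %% k).+1)%N by rewrite addnS -ei.
    by split; [rewrite divnMDl// (divn_small h) addn0 | rewrite modnMDl (modn_small h)].
  by rewrite e1 (@arc_next _ _ G (arc i) (arc i.+1)).
- have [e1 e2] : (i.+1 %/ k = (i %/ k).+1 /\ i.+1 %% k = 0)%N.
    have -> : i.+1 = ((i %/ k).+1 * k)%N by rewrite {1}ei -addnS h mulSn addnC.
    by rewrite mulnK// modnMl.
  rewrite e1 (@arc_wrap _ _ G (arc i.+1) (arc i))//=; last by rewrite -[in RHS]h.
  by rewrite -natr1; ring.
Qed.

Lemma lenE i : len i = arc_end G (arc i) - arc_start G (arc i).
Proof. by rewrite /len nodeS /node; ring. Qed.

Lemma len_gt0 i : 0 < len i.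
Proof. by rewrite lenE subr_gt0; exact: arc_lt. Qed.

Lemma node_lt i : node i < node i.+1.
Proof. by have := len_gt0 i; rewrite /len subr_gt0. Qed.

Lemma node_le i j : (i <= j)%N -> node i <= node j.
Proof.
move=> /subnKC <-; elim: (j - i)%N => [|n IH]; first by rewrite addn0.
by apply: le_trans IH _; rewrite addnS; exact/ltW/node_lt.
Qed.

Lemma polar_lift i phi : node i <= phi <= node i.+1 ->
  polar G phi = cen i + (rad i)%:C * cis phi.
Proof.
rewrite nodeS /node => h.
have e : phi = phi - (i %/ k)%:R * (2 * pi) + (i %/ k)%:Z%:~R * (2 * pi).
  by rewrite -pmulrn; ring.
rewrite e polar_shift cis_shift (@polar_arc _ _ G (arc i))//; lra.
Qed.

Lemma node_polar i :
  cen i + (rad i)%:C * cis (node i.+1) = cen i.+1 + (rad i.+1)%:C * cis (node i.+1).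
Proof.
by rewrite -!polar_lift ?lexx ?(ltW (node_lt _)).
Qed.

Lemma finite_positive_inf (f : 'I_k -> R) : (forall j, 0 < f j) ->
  exists2 c, 0 < c & forall j, c <= f j.
Proof.
move=> f0; pose j0 := arc 0.
have [j _ jmin] := @arg_minP _ _ _ j0 xpredT f isT.
by exists (f j) => // i; exact: jmin.
Qed.

Lemma rad_len_bounds : exists Rm g l : R, [/\ 0 < g, 0 < l,
  forall i, rad i <= Rm, forall i, g <= `|rad i.+1 - rad i| & forall i, l <= len i].
Proof.
(* A lower bound for the inverse radii is an upper bound for the radii. *)
have [c c0 hc] := @finite_positive_inf (fun j => (Defs.radius G j)^-1)
  (fun j => ltac:(by rewrite invr_gt0 radius_gt0)).
have [g g0 hg] := @finite_positive_inf (fun j => `|Defs.radius G (ordS j) - Defs.radius G j|)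
  (fun j => ltac:(by rewrite normr_gt0 subr_eq0 radius_next)).
have [l l0 hl] := @finite_positive_inf (fun j => arc_end G j - arc_start G j)
  (fun j => ltac:(by rewrite subr_gt0 arc_lt)).
exists c^-1, g, l; split => // i.
- by rewrite -[rad i]invrK lef_pV2 ?posrE ?invr_gt0 ?rad_gt0// hc.
- have -> : rad i.+1 = Defs.radius G (ordS (arc i)); last exact: hg.
  by congr Defs.radius; apply: val_inj; rewrite /= -addn1 -modnDml addn1.
- by rewrite lenE.
Qed.

End Lift.

(** * Scales determined by the gap between consecutive radii *)

Section Scales.
Context {R : realType}.
Implicit Types (r h g : R).

Lemma crossing_scale_of_gap r r' g Rm h : 0 < r -> 0 < g -> r + g <= r' -> r' <= Rm ->
  let eta := g / (24 * Rm) in let eps := eta / Rm in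
  0 < h <= eta ->
  crossing_scale r r' (h * (eps * r)) (h * (eps * r')) (h * (eps * (g / 4))) h eta.
Proof.
move=> r0 g0 rg rR eta eps /andP[h0 h_eta].
have R0 : 0 < Rm by lra.
have eta0 : 0 < eta by rewrite divr_gt0//; lra.
have eps0 : 0 < eps by rewrite divr_gt0.
have e1 : eta * Rm = g / 24 by rewrite /eta; field; exact: lt0r_neq0.
have e2 : eps * Rm = eta by rewrite /eps divfK// lt0r_neq0.
have eta24 : eta <= 1 / 24 by rewrite -(ler_pM2r R0) e1; lra.
have er' : eps * r' <= eta by rewrite -e2 ler_pM2l.
have er : eps * r < eps * r' by rewrite ltr_pM2l//; lra.
have er0 : 0 < eps * r by rewrite mulr_gt0.
have he0 : 0 < h * eps by rewrite mulr_gt0.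
have r'0 : 0 < r' by lra.
clearbody eps eta.
split => //.
- by rewrite mulr_gt0.
- by apply: mulr_ge0; [lra | apply: mulr_ge0; lra].
- by have : h * eps * g <= h * eps * (r' - r) by [rewrite ler_pM2l//; lra]; lra.
- by rewrite ltr_pM2l.
- have : h * (8 * (eps * r')) <= h * 1 by [rewrite ler_pM2l//; lra]; lra.
- by apply/andP; split; lra.
- by apply/andP; split; lra.
(* Here [t ^+ 2 / 2 <= 8 * h ^+ 2 <= eta], since [h <= eta <= 1 / 24]. *)
- move=> t t4; apply: le_trans (sin_ge_cubic _); last by lra.
  rewrite mulrC ler_wpM2l//; first by lra.
  have : t ^+ 2 <= (4 * h) ^+ 2 by rewrite lerXn2r ?nnegrE; lra.
  nra.
(* This is [scale_key] divided by [r' * h ^+ 2 * eps]. The factors lose at most [5 * eta]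
   relatively, while [r + r' - g / 4] exceeds [2 * r] by at least [3 * g / 4], and
   [eta * Rm = g / 24]. *)
- have k1 : 2 * r < (1 - eta) ^+ 2 * (1 - eps * r - 2 * (eps * r')) * (r + r' - g / 4).
    have : 1 - 5 * eta <= (1 - eta) ^+ 2 * (1 - eps * r - 2 * (eps * r')) by nra.
    have : 2 * r < (1 - 5 * eta) * (r + r' - g / 4) by nra.
    nra.
  have k2 : 0 < r' * h ^+ 2 * eps by rewrite !mulr_gt0.
  rewrite -(ltr_pM2l k2) in k1.
  have -> : r * (2 * (h * (eps * r'))) * h = r' * h ^+ 2 * eps * (2 * r) by ring.
  apply: lt_le_trans k1 _; rewrite le_eqVlt; apply/orP; left; apply/eqP; ring.
Qed.

Lemma crossing_scales_of_gap r r' g Rm h : 0 < r -> 0 < r' -> 0 < g ->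
  g <= `|r' - r| -> r <= Rm -> r' <= Rm ->
  let eta := g / (24 * Rm) in let eps := eta / Rm in
  0 < h <= eta ->
  crossing_scales r r' (h * (eps * r)) (h * (eps * r')) (h * (eps * (g / 4))) h eta.
Proof.
move=> r0 r'0 g0 gr rR r'R eta eps h_eta.
have [rr|rr] := leP 0 (r' - r).
  rewrite ger0_norm// in gr; left.
  have S := @crossing_scale_of_gap r r' g Rm h r0 g0 ltac:(lra) r'R h_eta.
  by split => //; case: S.
rewrite ltr0_norm// in gr; right.
have S := @crossing_scale_of_gap r' r g Rm h r'0 g0 ltac:(lra) rR h_eta.
by split => //; case: S.
Qed.

End Scales.

(** * Existence of a billiard polygon with given impact numbers *)

Section Itinerary.
Context {R : realType}.
Variables (k : nat) (G : circular_polygon R k).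

Let rad := rad G.
Let len := len G.
Let node := node G.

Lemma modn_periodic (T : Type) (f : nat -> T) m i :
  (forall j, f (j + m)%N = f j) -> f (i %% m)%N = f i.
Proof.
move=> fm; rewrite {2}(divn_eq i m) addnC.
by elim: (i %/ m)%N => [|n IH]; rewrite ?addn0// mulSn addnCA addnC fm.
Qed.

Lemma box_sub (h p p' : R) : 0 < p -> 0 < p' -> 8 * p <= h -> 8 * p' <= h ->
  [/\ 0 <= box_lo h p p', box_lo h p p' <= box_hi h p p', box_hi h p p' <= 2 * h &
   box_hi h p p' <= box_lo h p p' + h].
Proof. by move=> p0 p'0 ph p'h; rewrite /box_lo /box_hi; case: ltP => ?; split; lra. Qed.

Lemma gap_angle_bounds (l h tau c N x y del : R) :
  0 < h -> tau <= 1 -> 0 < l -> c <= l / 2 -> 2 * h * (c + 4 * h) <= l * del ->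
  `|2 * N * (h * tau) - l| <= c -> 0 <= x <= 2 * h -> 0 <= y <= 2 * h -> 0 < tau ->
  0 < N /\ h * tau - del <= (l - x - y) / (2 * N) <= h * tau + del.
Proof.
move=> h0 tau1 l0 cl hdel /ler_normlP[b1 b2] xb yb tau0.
have ht0 : 0 < h * tau by rewrite mulr_gt0.
have N0 : 0 < N.
  have : 0 < N * (2 * (h * tau)) by lra.
  by rewrite pmulr_lgt0//; lra.
have hN : l / 2 <= 2 * N * h.
  have : N * (h * tau) <= N * h by rewrite ler_pM2l// ler_piMr// ltW.
  lra.
have ch : 0 <= c + 4 * h by lra.
have key : c + 4 * h <= 2 * N * del.
  have d0 : 0 <= del.
    have : 0 <= l * del by apply: le_trans hdel; rewrite mulr_ge0//; lra.
    by rewrite pmulr_rge0.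
  rewrite -(ler_pM2l (_ : 0 < 2 * h)); last by lra.
  apply: le_trans hdel _.
  have : l * del <= (4 * N * h) * del by rewrite ler_wpM2r//; lra.
  lra.
split=> //; rewrite ler_pdivlMr ?ler_pdivrMr; lra.
Qed.

Definition sliding_angle (N : nat -> nat) (xs ys : nat -> R) (i : nat) : R :=
  (len i - xs i - ys i) / (2 * (N i)%:R).

(** The last field puts the first impact on each arc in a window of length [h] that does not depend
    on [N]. Impacts on one arc are more than [h] apart, so the window tells the first impact from
    the later ones. *)
Record itinerary (p : nat) (h : R) (lo : nat -> R) (N : nat -> nat)
    (xs ys : nat -> R) : Prop := Itinerary {
  itinerary_gaps : forall i, (0 < N i)%N;
  itinerary_xs : forall i, 0 < xs i;
  itinerary_ys : forall i, 0 < ys i;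
  itinerary_angle : forall i, h / 2 < sliding_angle N xs ys i < pi / 2;
  itinerary_reflects : forall i,
    reflects G (node i.+1 - ys i, sliding_angle N xs ys i)
      (node i.+1 + xs i.+1, sliding_angle N xs ys i.+1);
  itinerary_gaps_per : forall i, N (i + p * k)%N = N i;
  itinerary_xs_per : forall i, xs (i + p * k)%N = xs i;
  itinerary_ys_per : forall i, ys (i + p * k)%N = ys i;
  itinerary_lo : forall i, lo i <= xs i.+1 <= lo i + h
}.

(* [eps] weighs the radii so that the sliding angles, close to h (1 - eps r_i),
   decrease into an arc of larger radius. *)
Theorem itinerary_exists : exists (eps c h0 : R) (lo : R -> nat -> R),
  [/\ 0 < c, 0 < h0, forall i, 1 / 2 <= 1 - eps * rad i <= 1,
   forall h i t, lo h (i + t * k)%N = lo h i &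
   forall (p : nat) (h : R) (N : nat -> nat), (0 < p)%N -> 0 < h <= h0 ->
     (forall i, N (i + p * k)%N = N i) ->
     (forall i, `|2 * (N i)%:R * (h * (1 - eps * rad i)) - len i| <= c) ->
   exists xs ys : nat -> R, itinerary p h (lo h) N xs ys].
Proof.
have [Rm [g [l [g0 l0 hR hg hl]]]] := rad_len_bounds G.
have r0 i : 0 < rad i by exact: rad_gt0.
have Rm0 : 0 < Rm by apply: lt_le_trans (r0 0%N) (hR 0%N).
pose eta := g / (24 * Rm); pose eps := eta / Rm; pose mu := eps * (g / 4).
have eta0 : 0 < eta by rewrite divr_gt0//; lra.
have eps0 : 0 < eps by rewrite divr_gt0.
have mu0 : 0 < mu by rewrite mulr_gt0//; lra.
have gR : g <= Rm.
  have := hg 0%N; have := r0 0%N; have := r0 1%N; have := hR 0%N; have := hR 1%N.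
  rewrite -/(rad 0) -/(rad 1); case: (leP 0 (rad 1 - rad 0)) => ?.
    by rewrite ger0_norm//; lra.
  by rewrite ltr0_norm//; lra.
have eta24 : eta <= 1 / 24.
  by rewrite /eta ler_pdivrMr; lra.
have epsR : eps * Rm = eta by rewrite /eps divfK// lt0r_neq0.
have epsr i : 0 < eps * rad i <= eta.
  by rewrite mulr_gt0//= -epsR ler_pM2l// hR.
have mu2 : mu <= 1 / 8.
  have : eps * g <= eta by rewrite -epsR ler_pM2l.
  by rewrite /mu; lra.
(* These give [2 * h * (c + 4 * h) <= l * (h * mu)], so the sliding angles stay within [h * mu] of
   [h * (1 - eps * rad i)]. *)
pose c := l * mu / 4; pose h0 := Num.min eta (l * mu / 16).
have lmu : 0 < l * mu by rewrite mulr_gt0.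
pose P h i := h * (eps * rad i).
pose lo h i := box_lo h (P h i.+1) (P h i).
have scales h i : 0 < h <= eta ->
    crossing_scales (rad i) (rad i.+1) (P h i) (P h i.+1) (h * mu) h eta.
  by apply: crossing_scales_of_gap (hg i) _ _ => //; exact: hR.
clearbody mu eps eta; clear g0 hR hg Rm0 gR epsR.
exists eps, c, h0, lo; split.
- by rewrite /c; lra.
- by rewrite lt_min eta0; lra.
- by move=> i; have := epsr i; lra.
- by move=> h i t; rewrite /lo /P /rad -addSn !radD.
move=> p h N p0 /andP[hpos]; rewrite le_min => /andP[h_eta h_l] Nper Nclose.
pose m := (p * k)%N; have m0 : (0 < m)%N by rewrite muln_gt0 p0 (arcs_gt0 G).
have P0 i : 0 < P h i by rewrite /P mulr_gt0//; have := epsr i; lra.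
have P8 i : 8 * P h i <= h.
  have : h * (8 * (eps * rad i)) <= h * 1 by rewrite ler_pM2l//; have := epsr i; lra.
  by rewrite /P; lra.
have box i j := box_sub (P0 i) (P0 j) (P8 i) (P8 j).
have angles i x y : 0 <= x <= 2 * h -> 0 <= y <= 2 * h ->
    0 < (N i)%:R :> R /\
    h - P h i - h * mu <= (len i - x - y) / (2 * (N i)%:R) <= h - P h i + h * mu.
  have -> : h - P h i = h * (1 - eps * rad i) by rewrite /P; ring.
  move=> xb yb; have := epsr i => ei; have li := hl i; rewrite -/(len i) in li.
  apply: (gap_angle_bounds hpos _ _ _ _ (Nclose i)) => //; try lra.
  - rewrite /c; have : l * mu <= l * (1 / 8) by rewrite ler_pM2l.
    lra.
  - have e1 : h * (l * mu) <= h * (len i * mu).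
      by rewrite ler_pM2l// ler_pM2r.
    have e2 : h * (c + 4 * h) <= h * (l * mu / 2) by rewrite ler_pM2l// /c; lra.
    lra.
pose o i : 'I_m := Ordinal (ltn_pmod i m0).
have oS i : o i.+1 = ordS (o i).
  by apply: val_inj; rewrite /= -addn1 -modnDml addn1.
have o_rad i : rad (o i) = rad i.
  by apply: (@modn_periodic _ rad) => j; exact: radD.
have o_rad1 i : rad (o i).+1 = rad i.+1.
  by apply: (@modn_periodic _ (fun j => rad j.+1)) => j; rewrite -addSn; exact: radD.
have o_len i : len (o i) = len i.
  by apply: (@modn_periodic _ len) => j; exact: lenD.
have o_N i : N (o i) = N i by exact: modn_periodic.
have [||||ys0 [xs0 [yb xb ymax xmax]]] := @chain_argmax R m
  (fun i y x => chord (rad i) y (rad i.+1) x)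
  (fun i x y => 2 * rad i * (N i)%:R * sin ((len i - x - y) / (2 * (N i)%:R)))
  (fun i => box_lo h (P h i) (P h i.+1)) (fun i => box_hi h (P h i) (P h i.+1))
  (fun i => box_lo h (P h i.+1) (P h i)) (fun i => box_hi h (P h i.+1) (P h i)).
- by move=> i; exact: continuous_chord.
- by move=> i; exact: continuous_arc_length.
- by move=> i; have [] := box i i.+1.
- by move=> i; have [] := box i.+1 i.
(* [xs i] follows node [i], whereas [xs0] is indexed by the arc before the node; hence the
   predecessor. *)
pose ys i := ys0 (o i); pose xs i := xs0 (ord_pred (o i)).
have xsS i : xs i.+1 = xs0 (o i) by rewrite /xs oS ordSK.
have o_P i : P h (o i) = P h i by rewrite /P o_rad.
have o_P1 i : P h (o i).+1 = P h i.+1 by rewrite /P o_rad1.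
have yb' i : box_lo h (P h i) (P h i.+1) <= ys i <= box_hi h (P h i) (P h i.+1).
  by have := yb (o i); rewrite o_P o_P1.
have xb' i : box_lo h (P h i.+1) (P h i) <= xs i.+1 <= box_hi h (P h i.+1) (P h i).
  by have := xb (o i); rewrite o_P o_P1 -xsS.
have xper i : xs (i + m)%N = xs i.
  by rewrite /xs; congr (xs0 (ord_pred _)); apply: val_inj; rewrite /= modnDr.
have yper i : ys (i + m)%N = ys i.
  by rewrite /ys; congr ys0; apply: val_inj; rewrite /= modnDr.
have y2 i : 0 <= ys i <= 2 * h.
  by have := yb' i; have [] := box i i.+1; lra.
have x2' i : 0 <= xs i.+1 <= 2 * h.
  by have := xb' i; have [] := box i.+1 i; lra.
have x2 i : 0 <= xs i <= 2 * h.
  by rewrite -xper -(prednK m0) addnS; exact: x2'.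
exists xs, ys; pose th := sliding_angle N xs ys.
have crossing i : [/\ 0 < ys i,
      dirX (rad i) (ys i) (rad i.+1) (xs i.+1) =
        chord (rad i) (ys i) (rad i.+1) (xs i.+1) * cos (th i) &
      dirY (rad i) (ys i) (rad i.+1) (xs i.+1) =
        chord (rad i) (ys i) (rad i.+1) (xs i.+1) * sin (th i)] /\
   [/\ 0 < xs i.+1,
      dirX (rad i.+1) (xs i.+1) (rad i) (ys i) =
        chord (rad i) (ys i) (rad i.+1) (xs i.+1) * cos (th i.+1) &
      dirY (rad i.+1) (xs i.+1) (rad i) (ys i) =
        chord (rad i) (ys i) (rad i.+1) (xs i.+1) * sin (th i.+1)].
  have := @crossing_boxes_max R (rad i) (rad i.+1) (P h i) (P h i.+1) (h * mu) h eta
    (N i)%:R (len i - xs i) (N i.+1)%:R (len i.+1 - ys i.+1) (ys i) (xs i.+1) (scales h i _).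
  have e : (len i.+1 - ys i.+1 - xs i.+1) / (2 * (N i.+1)%:R) = th i.+1.
    by rewrite /th /sliding_angle addrAC.
  rewrite /= e hpos h_eta => /(_ isT); apply.
  - exact: (angles i _ _ (x2 i) (y2 i)).1.
  - exact: (angles i.+1 _ _ (x2' i) (y2 i.+1)).1.
  - move=> z zb; apply: (angles i _ _ (x2 i) _).2.
    by have [] := box i i.+1; lra.
  - move=> z zb; rewrite [len _ - _ - z]addrAC; apply: (angles i.+1 _ _ _ (y2 i.+1)).2.
    by have [] := box i.+1 i; lra.
  - exact: yb'.
  - exact: xb'.
  - move=> z zb; have := ymax (o i) z.
    rewrite o_P o_P1 o_rad o_rad1 o_N o_len -xsS => /(_ zb).
    by rewrite -/(xs i) -/(ys i).
  - move=> z zb; have := xmax (o i) z.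
    rewrite o_P o_P1 o_rad o_rad1 -oS o_rad o_N o_len -xsS => /(_ zb).
    by rewrite -/(ys i) -/(ys i.+1) [len _ - _ - ys _]addrAC.
have xpos i : 0 < xs i.
  by rewrite -xper -(prednK m0) addnS; have [_ []] := crossing (i + m.-1)%N.
have ypos i : 0 < ys i by have [[]] := crossing i.
have pi2 := @pi_ge2 R.
have thb i : h / 2 < th i < pi / 2.
  have tb : h - P h i - h * mu <= th i <= h - P h i + h * mu :=
    (angles i _ _ (x2 i) (y2 i)).2.
  have : h * mu <= h * (1 / 8) by rewrite ler_pM2l.
  have := P0 i; have := P8 i; lra.
have Npos i : 0 < (N i)%:R :> R := (angles i _ _ (x2 i) (y2 i)).1.
(* A positive sliding angle forces the two half-steps to fit on the arc, so the impacts lie on the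
   intended arcs. *)
have room i : xs i + ys i < node i.+1 - node i.
  have := thb i => /andP[+ _]; rewrite /th /sliding_angle ltr_pdivlMr; last by have := Npos i; lra.
  have : 0 < h / 2 * (2 * (N i)%:R) by rewrite !mulr_gt0 ?invr_gt0.
  by have -> : len i = node i.+1 - node i by []; lra.
split => //.
- by move=> i; rewrite -(ltr0n R).
- move=> i; have [[_ X1 Y1] [_ X2 Y2]] := crossing i.
  have ti := thb i; have ti1 := thb i.+1.
  apply: (reflects_node (node_polar G i) _ _ _ _ _ _ _ _ X1 Y1 X2 Y2) => //.
  + by apply: polar_lift; have := room i; have := ypos i; have := xpos i; rewrite -/node; lra.
  + apply: polar_lift; have := room i.+1; have := ypos i.+1; have := xpos i.+1.
    by rewrite -/node; lra.
  + have := x2' i; have := y2 i; lra.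
  + lra.
  + lra.
  + have xu := x2' i; have yu := y2 i; have x0 := xpos i.+1; have y0 := ypos i.
    by apply: chord_small_gt0 => //; move: xu yu h_eta eta24 x0 y0; clear; lra.
- by move=> i; have := xb' i; have [] := box i.+1 i; rewrite /lo; lra.
Qed.

End Itinerary.

(** * Orbits with a prescribed itinerary *)

Section ItineraryOrbit.
Context {R : realType}.
Variables (k : nat) (G : circular_polygon R k).

Definition next_state (N : nat -> nat) (s : nat * nat) : nat * nat :=
  if (s.2 < N s.1)%N then (s.1, s.2.+1) else (s.1.+1, 0)%N.

(* [(i, l)] is the impact number [l] on the [i]-th visited arc. *)
Definition state N n := iter n (next_state N) (0, 0)%N.

Lemma state_le N n : ((state N n).2 <= N (state N n).1)%N.
Proof. by elim: n => //= n; rewrite /next_state; case: ifP. Qed.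

(** Arc [i] carries [N i + 1] impacts, numbered from 0, and the sum counts those on earlier arcs. *)
Lemma state_at N j l : (l <= N j)%N ->
  state N (\sum_(i < j) (N i).+1 + l) = (j, l).
Proof.
elim: j l => [|j IHj] l; elim: l => [|l IHl] lN.
- by rewrite big_ord0.
- by rewrite addnS /= -/(state _ _) IHl ?(ltnW lN)// /next_state/= lN.
- rewrite big_ord_recr/= addnS addn0 /= -/(state _ _) IHj//.
  by rewrite /next_state/= ltnn.
- by rewrite addnS /= -/(state _ _) IHl ?(ltnW lN)// /next_state/= lN.
Qed.

Lemma node_itv_inj (X : R) i j : node G i < X < node G i.+1 ->
  node G j < X < node G j.+1 -> i = j.
Proof.
move=> /andP[h1 h2] /andP[h3 h4].
case: (ltngtP i j) => // ij.
- by have := lt_trans (lt_le_trans h2 (node_le G ij)) h3; rewrite ltxx.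
- by have := lt_trans (lt_le_trans h4 (node_le G ij)) h1; rewrite ltxx.
Qed.

Definition impact (N : nat -> nat) (xs ys : nat -> R) (n : nat) : R * R :=
  let: (i, l) := state N n in
  (node G i + xs i + 2 * l%:R * sliding_angle G N xs ys i, sliding_angle G N xs ys i).

Section One.
Variables (p : nat) (h : R) (lo : nat -> R) (N : nat -> nat) (xs ys : nat -> R).
Hypothesis h0 : 0 < h.
Hypothesis it : itinerary G p h lo N xs ys.
Let th := sliding_angle G N xs ys.

Lemma sliding_angle_gt0 i : 0 < th i < pi.
Proof.
have : h / 2 < th i < pi / 2 := itinerary_angle it i.
by have := @pi_gt0 R; have := h0; lra.
Qed.

Lemma last_impact i : node G i + xs i + 2 * (N i)%:R * th i = node G i.+1 - ys i.
Proof.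
have N0 : (N i)%:R != 0 :> R by rewrite pnatr_eq0 -lt0n (itinerary_gaps it).
have -> : 2 * (N i)%:R * th i = len G i - xs i - ys i.
  by rewrite /th /sliding_angle mulrC divfK// mulf_neq0 ?N0// pnatr_eq0.
rewrite /len; ring.
Qed.

Lemma impact_itv i l : (l <= N i)%N ->
  node G i < node G i + xs i + 2 * l%:R * th i < node G i.+1.
Proof.
move=> lN; have := last_impact i; have := itinerary_ys it i.
have := itinerary_xs it i; have /andP[t0 _] := sliding_angle_gt0 i.
have : 2 * l%:R * th i <= 2 * (N i)%:R * th i.
  by rewrite ler_pM2r// ler_pM2l// ler_nat.
have : 0 <= 2 * l%:R * th i by apply: mulr_ge0; [rewrite mulr_ge0// ler0n | exact: ltW].
lra.
Qed.

Lemma impact_reflects n : reflects G (impact N xs ys n) (impact N xs ys n.+1).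
Proof.
rewrite /impact /= -/(state N n); case: (state N n) (state_le N n) => i l /= lN.
rewrite /next_state /=; case: ifP => [lt_lN|/negbT].
  have e : node G i + xs i + 2 * l.+1%:R * th i =
      node G i + xs i + 2 * l%:R * th i + 2 * th i.
    by rewrite -natr1; ring.
  rewrite -/(th i) e; apply: (@reflects_arc _ _ _ (cen G i) (rad G i)).
  - by apply: polar_lift; have := impact_itv lN; lra.
  - by rewrite -e; apply: polar_lift; have := impact_itv lt_lN; lra.
  - exact: sliding_angle_gt0.
rewrite -leqNgt => Nl; have -> : l = N i by apply/eqP; rewrite eqn_leq lN.
rewrite -!/(th _) last_impact mulr0 mul0r addr0.
exact: (itinerary_reflects it i).
Qed.

Lemma impact_period q : q = (\sum_(i < p * k) (N i).+1)%N ->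
  impact N xs ys q = ((impact N xs ys 0).1 + 2 * pi * p%:R, (impact N xs ys 0).2).
Proof.
move=> ->; have := @state_at N (p * k) 0 (leq0n _); rewrite addn0 /impact => -> /=.
have thp : sliding_angle G N xs ys (p * k) = sliding_angle G N xs ys 0.
  rewrite /sliding_angle -[(p * k)%N]add0n.
  by rewrite lenD (itinerary_gaps_per it) (itinerary_xs_per it) (itinerary_ys_per it).
rewrite thp; congr (_, _); rewrite -[(p * k)%N]add0n nodeD (itinerary_xs_per it); ring.
Qed.

Lemma itinerary_trajectory :
  periodic_trajectories G p (\sum_(i < p * k) (N i).+1)%N
    (billiard_orbit G (phase_point (impact N xs ys 0))).
Proof.
apply: periodic_trajectory_of_sequence; first exact: impact_reflects.
  move=> n; rewrite /impact; case: (state N n) => i l /=; exact: sliding_angle_gt0.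
exact: impact_period.
Qed.

End One.

(** Equal orbits are shifts of each other. Positions match the visited arcs up to whole turns, the
    windows match the first impacts, and then the impact numbers agree arc by arc. *)
Lemma itinerary_rotation (p : nat) (h : R) (lo : nat -> R) N xs ys N' xs' ys' :
  (0 < p)%N -> 0 < h -> (forall i t, lo (i + t * k)%N = lo i) ->
  itinerary G p h lo N xs ys -> itinerary G p h lo N' xs' ys' ->
  billiard_orbit G (phase_point (impact N xs ys 0)) =
  billiard_orbit G (phase_point (impact N' xs' ys' 0)) ->
  exists t : 'I_p, forall i, N' i = N (i + t * k)%N.
Proof.
move=> p0 h0 loD it it' /orbit_eq_shift.
case=> [||n [c eF]]; [exact: impact_reflects it | exact: impact_reflects it' |].
have t0 := @twopi_gt0 R.
have itv s : let: (i, l) := state N (n + s) in let: (i', l') := state N' s in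
    [/\ node G i < (impact N xs ys (n + s)).1 < node G i.+1,
        node G i' < (impact N' xs' ys' s).1 < node G i'.+1 &
        (impact N' xs' ys' s).1 = (impact N xs ys (n + s)).1 + c%:~R * (2 * pi)].
  have := eF s; rewrite /impact.
  case: (state N (n + s)) (state_le N (n + s)) => i l /= /(impact_itv h0 it) b.
  by case: (state N' s) (state_le N' s) => i' l' /= /(impact_itv h0 it') b' [e _].
(* The second sequence starts on arc 0 and the first never visits a negative index, so [c] cannot be
   positive. *)
have [u [cu arcs]] : exists u : nat, c = - u%:Z /\
    forall s, (state N (n + s)).1 = ((state N' s).1 + u * k)%N.
  case: c itv {eF} => u itv.
    have e s : ((state N' s).1 = (state N (n + s)).1 + u * k)%N.
      have := itv s; case: (state N (n + s)) (state N' s) => i l [i' l'] /= [b b' e].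
      apply: node_itv_inj b' _; rewrite e -addSn !nodeD.
      by move: b; rewrite -pmulrn; lra.
    exists 0%N; have u0 : u = 0%N.
      have := e 0%N; rewrite /= => /eqP; rewrite eq_sym addn_eq0 muln_eq0.
      by rewrite -[(k == 0)%N]negbK -lt0n (arcs_gt0 G)/= orbF => /andP[_ /eqP].
    by split=> [|s]; rewrite ?e u0 ?oppr0// mul0n !addn0.
  exists u.+1; split=> [|s]; first by rewrite NegzE.
  have := itv s; case: (state N (n + s)) (state N' s) => i l [i' l'] /= [b b' e].
  apply: node_itv_inj b _; rewrite -addSn !nodeD.
  by move: b'; rewrite e NegzE mulrNz -pmulrn; lra.
(* Both [xs] at arc [u * k] and [xs'] at arc 0 lie in the same window of length [h]; an impact
   number [l > 0] would add more than [h]. *)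
have st0 : state N n = (u * k, 0)%N.
  have := arcs 0%N; have := eF 0%N; rewrite addn0 /impact /=.
  case: (state N n) => i l /= [e et] ei; rewrite add0n in ei; subst i.
  case: l e => [//|l e]; exfalso; move: e.
  rewrite cu mulrNz -pmulrn -[(u * k)%N]add0n nodeD.
  have /andP[th0 _] := itinerary_angle it (0 + u * k).
  have pk0 : (0 < p * k)%N by rewrite muln_gt0 p0 (arcs_gt0 G).
  have b1 : lo (p * k).-1 <= xs (0 + u * k) <= lo (p * k).-1 + h.
    have -> : xs (0 + u * k)%N = xs ((p * k).-1 + u * k).+1.
      by rewrite -(itinerary_xs_per it); congr xs; move: pk0; lia.
    by rewrite -(loD (p * k).-1 u); exact: itinerary_lo it _.
  have b2 : lo (p * k).-1 <= xs' 0%N <= lo (p * k).-1 + h.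
    have -> : xs' 0%N = xs' (p * k).-1.+1.
      by rewrite -(itinerary_xs_per it'); congr xs'; move: pk0; lia.
    exact: itinerary_lo it' _.
  have : h * l.+1%:R < 2 * l.+1%:R * sliding_angle G N xs ys (0 + u * k).
    have : 0 < l.+1%:R :> R by rewrite ltr0n.
    by nra.
  have : h <= h * l.+1%:R by rewrite ler_pMr// ler1n.
  have := itinerary_xs it (0 + u * k).
  lra.
(* Both sequences leave their arcs at the same moments, so the impact numbers within the arcs stay
   equal. *)
have eqst s : (state N (n + s)).2 = (state N' s).2.
  elim: s => [|s IH]; first by rewrite addn0 st0.
  have := arcs s.+1; have := arcs s; rewrite addnS /= -!/(state _ _).
  case: (state N (n + s)) IH => i l; case: (state N' s) => i' l' /= -> ->.
  by rewrite /next_state /=; do 2![case: ifP => _ /=] => ?; lia.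
(* Examined at the last impact on arc [i] of the second sequence: the first must also change arcs
   there. *)
have rot i : N' i = N (i + u * k)%N.
  have := state_at (leqnn (N' i)); set s := (_ + _)%N => st'.
  have es := eqst s; have as1 := arcs s.+1; have as0 := arcs s.
  have := state_le N (n + s).
  move: es as1 as0; rewrite addnS /= -!/(state _ _) st' /next_state /= ltnn.
  case: (state N (n + s)) => j l /= -> + ej; rewrite ej.
  case: ltnP => /= [_ ?|h1 _ h2]; first by lia.
  by apply/eqP; rewrite eqn_leq h1 h2.
exists (Ordinal (ltn_pmod u p0)) => i /=.
rewrite rot {1}(divn_eq u p) mulnDl addnA addnAC.
elim: (u %/ p)%N => [|w IH]; first by rewrite mul0n mul0n addn0.
by rewrite mulSn mulnDl [(p * k + _)%N]addnC addnA (itinerary_gaps_per it).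
Qed.

End ItineraryOrbit.

(** * Counting *)

Section Counting.
Context {R : realType}.

(** Each fibre of [f] has at most [p] elements, since [E] from one representative determines an
    element by its label in ['I_p]. An infinite [P] has counting measure [+oo]. *)
Lemma counting_fibers (T : choiceType) (S : finType) (f : S -> T) (P : set T) (p : nat)
    (E : S -> 'I_p -> S -> Prop) :
  (0 < p)%N -> (forall s, P (f s)) ->
  (forall s s', f s = f s' -> exists t, E s t s') ->
  (forall s t s' s'', E s t s' -> E s t s'' -> s' = s'') ->
  ((#|S|%:R / p%:R)%:E <= counting (R := R) P)%E.
Proof.
move=> p0 Pf Eex Einj; rewrite /counting; case: ifPn => [/asboolP finP|_]; last first.
  exact: leey.
rewrite lee_fin ler_pdivrMr ?ltr0n// -natrM ler_nat.
pose U := undup [seq f s | s <- enum S].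
have fU s : f s \in U by rewrite mem_undup map_f// mem_enum.
have sizeU : (size U <= #|` fset_set P|)%N.
  apply: uniq_leq_size; first exact: undup_uniq.
  move=> u; rewrite mem_undup => /mapP[s _ ->].
  by rewrite in_fset_set// inE.
pose rep u := [pick s | f s == u].
pose g s : seq_sub U * 'I_p := (SeqSub (fU s),
  if rep (f s) is Some r then xget (Ordinal p0) [set t | E r t s] else Ordinal p0).
have ginj : injective g.
  move=> s s' [eU]; rewrite /rep eU; case: pickP => [r /eqP er|/(_ s')]; last by rewrite eqxx.
  have [t Et] := Eex r s (etrans er (esym eU)).
  have [t' Et'] := Eex r s' er.
  have H1 := xgetPex (Ordinal p0) (ex_intro [set t | E r t s] t Et).
  have H2 := xgetPex (Ordinal p0) (ex_intro [set t | E r t s'] t' Et').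
  by move=> e; rewrite e in H1; exact: Einj H1 H2.
apply: leq_trans (leq_card g ginj) _.
by rewrite card_prod card_ord card_seq_sub ?undup_uniq// leq_mul2r sizeU orbT.
Qed.

End Counting.

(** * Impact numbers with a fixed sum, close to given real numbers *)

Section GapSequences.
Context {R : realType}.
Variables (m D : nat) (nu : nat -> R).
Hypothesis m0 : (0 < m)%N.
Hypothesis nu_big : forall i, D.+2%:R <= nu i.

Definition cumul (i : nat) : R := \sum_(j < i) nu j.

Implicit Type e : {ffun 'I_m.-1 -> 'I_D.+1}.

(** Only the [m.-1] interior marks are moved: [insub] rejects [i = m], while [i = 0] needs its own
    test because [0.-1 = 0]. *)
Definition offset e (i : nat) : nat :=
  if insub i.-1 is Some j then if i == 0%N then 0%N else e j else 0%N.

(* Perturbing the rounded partial sums, rather than the terms, leaves the total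
   number of impacts unchanged. *)
Definition mark e (i : nat) : nat := (Num.truncn (cumul i) + offset e i)%N.

(* An arc carrying [n] impacts has [n - 1] gaps; the index is taken modulo [m]. *)
Definition gaps e (i : nat) : nat :=
  (mark e (i %% m).+1 - mark e (i %% m)).-1.

Lemma offset_le e i : (offset e i <= D)%N.
Proof.
rewrite /offset; case: insubP => [j _ _|_]//; case: ifP => // _.
by rewrite -ltnS.
Qed.

Lemma offset0 e : offset e 0 = 0%N.
Proof. by rewrite /offset; case: insub. Qed.

Lemma offset_last e : offset e m = 0%N.
Proof. by rewrite /offset; case: insubP => // j; rewrite ltnn. Qed.

Lemma nu_ge0 i : 0 <= nu i.
Proof. by apply: le_trans (nu_big i). Qed.

Lemma cumul_ge0 i : 0 <= cumul i.
Proof. by apply: sumr_ge0 => j _; exact: nu_ge0. Qed.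

(** Rounding changes a difference of partial sums by less than 1, the offsets change it by at most
    [D], and the predecessor by 1. *)
Lemma mark_step e i :
  mark e i.+1 = (mark e i + (mark e i.+1 - mark e i).-1.+1)%N /\
  `|(mark e i.+1 - mark e i).-1%:R - nu i| <= D.+2%:R.
Proof.
have cS : cumul i.+1 = cumul i + nu i by rewrite /cumul big_ord_recr.
have /andP[a1 a2] := Num.Theory.truncn_itv (cumul_ge0 i).
have /andP[b1 b2] := Num.Theory.truncn_itv (cumul_ge0 i.+1).
have o1 := offset_le e i; have o2 := offset_le e i.+1.
have hnu := nu_big i.
have eM j : (mark e j)%:R = (Num.truncn (cumul j))%:R + (offset e j)%:R :> R by rewrite natrD.
have o1' : (offset e i)%:R <= D%:R :> R by rewrite ler_nat.
have o2' : (offset e i.+1)%:R <= D%:R :> R by rewrite ler_nat.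
have o3 : 0 <= (offset e i)%:R :> R by [].
have o4 : 0 <= (offset e i.+1)%:R :> R by [].
have lt_mark : (mark e i < mark e i.+1)%N.
  rewrite -(ltr_nat R) !eM.
  move: a1 a2 b1 b2 hnu; rewrite cS -!natr1; lra.
have e1 : mark e i.+1 = (mark e i + (mark e i.+1 - mark e i).-1.+1)%N.
  by rewrite prednK ?subn_gt0// subnKC// ltnW.
split=> //.
have := congr1 (fun n => n%:R : R) e1; rewrite /= natrD !eM -natr1.
move: a1 a2 b1 b2; rewrite cS -!natr1 ler_norml; lra.
Qed.

Lemma gaps_period e i : gaps e (i + m) = gaps e i.
Proof. by rewrite /gaps modnDr. Qed.

Lemma gaps_close e i : `|(gaps e i)%:R - nu (i %% m)| <= D.+2%:R.
Proof. exact: (mark_step e _).2. Qed.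

Lemma sum_gaps e i : (i <= m)%N -> \sum_(j < i) (gaps e j).+1 = mark e i.
Proof.
elim: i => [|i IH] im.
  by rewrite big_ord0 /mark offset0 addn0 /cumul big_ord0 Num.Theory.truncn0.
rewrite big_ord_recr/= (IH (ltnW im)) /gaps (modn_small im).
exact: (esym (mark_step e i).1).
Qed.

Lemma gaps_inj e e' : gaps e =1 gaps e' -> e = e'.
Proof.
move=> eg; apply/ffunP => j; apply: val_inj.
have jm : (j.+1 <= m)%N by have := ltn_ord j; lia.
have : mark e j.+1 = mark e' j.+1.
  by rewrite -!sum_gaps//; apply: eq_bigr => i _; rewrite eg.
rewrite /mark => /addnI; rewrite /offset/=; case: insubP => [u _ uj|]; last first.
  by rewrite ltn_ord.
by have -> : u = j by apply: val_inj.
Qed.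

End GapSequences.

(** * Number of trajectories for a given density of impacts *)

Section LowerBound.
Context {R : realType}.
Variables (k : nat) (G : circular_polygon R k).

Lemma cumul_period (nu : nat -> R) p : (forall i t, nu (i + t * k)%N = nu i) ->
  cumul nu (p * k) = p%:R * cumul nu k.
Proof.
move=> nuD; elim: p => [|p IH]; first by rewrite mul0r /cumul big_ord0.
rewrite mulSn addnC -natr1 mulrDl mul1r -IH /cumul big_split_ord/=; congr (_ + _).
by apply: eq_bigr => i _; rewrite addnC nuD.
Qed.

Lemma cumul_gt0 (nu : nat -> R) n : (0 < n)%N -> (forall i, 0 < nu i) ->
  0 < cumul nu n.
Proof.
case: n => // n _ nu0; rewrite /cumul big_ord_recl ltr_wpDr//.
by apply: sumr_ge0 => i _; exact: ltW.
Qed.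

(** Each of the [(p * k).-1] interior marks has [D.+1] free values. The superset [P] makes the bound
    available both for fixed [p] and for the union over [p]. *)
Lemma trajectories_lower_bound : exists S c h0 : R, [/\ 0 < S, 0 < c, 0 < h0 &
  forall (p q D : nat) (P : set (set (R * R))), (0 < p)%N -> (0 < q)%N ->
    periodic_trajectories G p q `<=` P ->
    let h := p%:R * S / q%:R in h <= h0 -> 2 * h * D.+3%:R <= c ->
    (((D.+1 ^ (p * k).-1)%N%:R / p%:R)%:E <= counting (R := R) P)%E].
Proof.
have [eps [c [h0 [lo [c0 h00 tau_b loD H]]]]] := itinerary_exists G.
have [_ [_ [l [_ l0 _ _ hl]]]] := rad_len_bounds G.
pose tau i := 1 - eps * rad G i.
have tau0 i : 0 < tau i by have := tau_b i; rewrite -/(tau i); lra.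
(* For a small parameter [h] one turn takes [S / h] impacts, so [h = p * S / q] yields [q] impacts
   in [p] turns. *)
pose S := cumul (fun i => len G i / (2 * tau i)) k.
have S0 : 0 < S.
  apply: cumul_gt0 (arcs_gt0 G) _ => i.
  by rewrite divr_gt0 ?len_gt0// mulr_gt0.
(* The bound by [c] keeps the gaps admissible; the bound by [l] makes every [nu i] at least
   [D.+2]. *)
exists S, (Num.min c l), h0; split => //; first by rewrite lt_min c0.
move=> p q D P p0 q0 subP h hh0; rewrite le_min => /andP[hc hlD].
have h_gt0 : 0 < h by rewrite /h divr_gt0 ?mulr_gt0 ?ltr0n.
have hE : h = p%:R * S / q%:R by [].
clearbody h.
pose nu i := len G i / (2 * (h * tau i)).
have nuD i t : nu (i + t * k)%N = nu i by rewrite /nu /tau lenD radD.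
have den0 i : 0 < 2 * (h * tau i) by rewrite !mulr_gt0.
have den_le i : 2 * (h * tau i) <= 2 * h.
  have /andP[_ t1] : 1 / 2 <= tau i <= 1 := tau_b i.
  have : h * tau i <= h * 1 by rewrite ler_pM2l.
  lra.
have D23 : D.+2%:R <= D.+3%:R :> R by rewrite ler_nat.
have nu_big i : D.+2%:R <= nu i.
  rewrite ler_pdivlMr//; apply: le_trans (hl i); apply: le_trans hlD.
  by rewrite mulrC; apply: ler_pM => //; exact: ltW.
have m0 : (0 < p * k)%N by rewrite muln_gt0 p0 (arcs_gt0 G).
have cum : cumul nu (p * k) = q%:R.
  rewrite cumul_period//.
  have -> : cumul nu k = S / h.
    rewrite /S /cumul mulr_suml; apply: eq_bigr => i _; rewrite /nu.
    by field; rewrite !lt0r_neq0.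
  by rewrite hE; field; rewrite !lt0r_neq0// ltr0n.
pose N (e : {ffun 'I_(p * k).-1 -> 'I_D.+1}) := gaps nu e.
have close e i : `|2 * (N e i)%:R * (h * tau i) - len G i| <= c.
  have g := gaps_close nu_big e i.
  rewrite (@modn_periodic _ nu) in g; last by move=> j; exact: nuD.
  have -> : 2 * (N e i)%:R * (h * tau i) - len G i =
      2 * (h * tau i) * ((gaps nu e i)%:R - nu i).
    by rewrite /nu; field; rewrite !lt0r_neq0.
  rewrite normrM gtr0_norm//; apply: le_trans hc.
  by apply: ler_pM => //; [exact: ltW | exact: le_trans g D23].
have sumN e : (\sum_(i < p * k) (N e i).+1)%N = q.
  rewrite sum_gaps// /mark cum.
  by rewrite offset_last addn0 natrK.
have it e : exists xy : (nat -> R) * (nat -> R), itinerary G p h (lo h) (N e) xy.1 xy.2.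
  have [|||xs [ys Hit]] := H p h (N e) p0.
  - by rewrite h_gt0.
  - by move=> i; exact: gaps_period.
  - exact: close.
  by exists (xs, ys).
have [xy xyP] := choice it.
pose f e := billiard_orbit G (phase_point (impact G (N e) (xy e).1 (xy e).2 0)).
have := @counting_fibers R _ _ f P p
  (fun e t e' => forall i, N e' i = N e (i + t * k)%N) p0.
rewrite card_ffun !card_ord; apply.
- move=> e; apply: subP; rewrite -(sumN e).
  exact: itinerary_trajectory h_gt0 (xyP e).
- move=> e e'; apply: itinerary_rotation p0 h_gt0 _ (xyP e) (xyP e').
  by move=> i t; exact: loD.
- move=> e t e' e'' h1 h2; apply: (gaps_inj m0 nu_big) => i.
  by rewrite -/(N e' i) h1 -h2.
Qed.

End LowerBound.

(** * Choice of the constants in the two bounds *)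

Theorem theorem4 (R : realType) (k : nat) (G : circular_polygon R k) :
  exists (c : nat -> R) (M h : R),
    [/\ forall p : nat, (0 < p)%N -> 0 < c p,
        0 < M,
        0 < h,
        forall p : nat, (0 < p)%N ->
          exists e : nat -> R,
            e =O_\oo (fun q : nat => q%:R ^+ (k * p - 2) : R) /\
            \forall q \near \oo,
              ((c p * q%:R ^+ (k * p - 1) + e q)%:E
                 <= counting (periodic_trajectories G p q))%E
      & \forall q \near \oo,
          ((M * expR (h * q%:R) / q%:R)%:E
             <= counting (all_periodic_trajectories G q))%E].
Proof.
have [S [c1 [h0 [S0 c10 h00 H]]]] := trajectories_lower_bound G.
(* [c1 / 8] permits [D = 1], that is, two values for each mark; [S / 2] ensures [p <= q / 2]. *)
pose h2 := Num.min h0 (Num.min (c1 / 8) (S / 2)).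
have h20 : 0 < h2 by rewrite !lt_min h00/=; apply/andP; split; lra.
have h2h0 : h2 <= h0 by rewrite ge_min lexx.
have h2c : h2 <= c1 / 8 by rewrite !ge_min lexx orbT.
have h2S : h2 <= S / 2 by rewrite !ge_min lexx !orbT.
pose a p : R := c1 / (4 * (p%:R * S)).
have a0 p : (0 < p)%N -> 0 < a p.
  by move=> p0; rewrite divr_gt0// !mulr_gt0// ltr0n.
(* The exponent is such that [expR (h * q) = 2 ^ X] with [X = q * h2 / S]; the factor [1 / 2] pays
   for replacing [X] by its integer part [p]. *)
exists (fun p => a p ^+ (k * p - 1) / p%:R), (1 / 2), (ln 2 * (h2 / S)); split.
- by move=> p p0; rewrite divr_gt0 ?ltr0n// exprn_gt0// a0.
- lra.
- by rewrite mulr_gt0 ?divr_gt0// ln_gt0// ltr1n.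
- move=> p p0; exists (fun=> 0); split.
    by apply/eqO_exP; exists 1 => //; apply: nearW => q; rewrite normr0 mul1r.
  have p0R : 0 < p%:R :> R by rewrite ltr0n.
  near=> q.
  have q0 : (0 < q)%N by near: q; exists 1%N.
  have q0R : 0 < q%:R :> R by rewrite ltr0n.
  have qS : p%:R * S / h0 <= q%:R by near: q; exact: nbhs_infty_ger.
  have qa : 8 / a p <= q%:R by near: q; exact: nbhs_infty_ger.
  have aq8 : 8 <= a p * q%:R by rewrite -ler_pdivrMl ?a0// mulrC.
  (* [X] is the largest value that the condition [2 * h * D.+3 <= c1] allows for [D.+3]. Half of it,
     [a p * q], remains below [D.+1] after rounding. *)
  pose X := 2 * (a p * q%:R); pose D := (Num.truncn X - 3)%N.
  have X0 : 0 <= X by rewrite /X; lra.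
  have /andP[t1 t2] := Num.Theory.truncn_itv X0.
  have D3 : (D + 3)%N = Num.truncn X.
    by rewrite /D subnK// -(ler_nat R); rewrite -natr1 in t2; rewrite /X in t2 *; lra.
  have D3R : D%:R + 3 = (Num.truncn X)%:R :> R by rewrite -natrD D3.
  rewrite -natr1 in t2.
  have Dle : (a p * q%:R) <= (D.+1)%:R by rewrite -natr1 /X in t2 *; lra.
  apply: (le_trans _ (H p q D _ p0 q0 (@subset_refl _ _) _ _)).
  + rewrite lee_fin addr0 mulrAC ler_pM2r ?invr_gt0// -exprMn natrX mulnC subn1.
    by rewrite lerXn2r ?nnegrE// mulr_ge0// ltW// a0.
  + by rewrite ler_pdivrMr// [h0 * _]mulrC -ler_pdivrMr.
  + have -> : D.+3%:R = (Num.truncn X)%:R :> R by rewrite -D3 addn3.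
    have hX : 2 * (p%:R * S / q%:R) * X = c1.
      by rewrite /X /a; field; rewrite !lt0r_neq0.
    by rewrite -hX ler_pM2l// !mulr_gt0// invr_gt0.
- near=> q.
  have q0 : (0 < q)%N by near: q; exists 1%N.
  have q0R : 0 < q%:R :> R by rewrite ltr0n.
  have qS : S / h2 <= q%:R by near: q; exact: nbhs_infty_ger.
  pose X := q%:R * (h2 / S); pose p := Num.truncn X.
  have X0 : 0 <= X by apply/ltW/mulr_gt0 => //; exact: divr_gt0.
  have /andP[t1 t2] := Num.Theory.truncn_itv X0; rewrite -/p in t1 t2.
  have X1 : 1 <= X by rewrite /X mulrA ler_pdivlMr// mul1r -ler_pdivrMr.
  have p0 : (0 < p)%N by rewrite Num.Theory.truncn_gt0.
  have p0R : 0 < p%:R :> R by rewrite ltr0n.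
  have X2 : X <= q%:R / 2.
    by rewrite ler_pM2l// ler_pdivrMr// mulrC.
  have pq : (p < q)%N by rewrite -(ltr_nat R); lra.
  have hq : p%:R * S / q%:R <= h2.
    by rewrite ler_pdivrMr// -ler_pdivlMr// (le_trans t1)// /X mulrCA mulrA.
  apply: (le_trans _ (H p q 1 _ p0 q0 _ _ _)).
  + rewrite lee_fin.
    have e1 : expR (ln 2 * (h2 / S) * q%:R) <= 2 * (2 ^ p)%N%:R.
      have -> : ln 2 * (h2 / S) * q%:R = ln 2 * X by rewrite /X; ring.
      have -> : 2 * (2 ^ p)%N%:R = expR (ln 2 * p.+1%:R) :> R.
        by rewrite -natrM -expnS natrX mulrC expRM_natl lnK// posrE.
      by rewrite ler_expR ler_pM2l ?ln_gt0 ?ltr1n// ltW.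
    (* Uses [k >= 2], hence [p * k - 1 >= 2 * p - 1 >= p]. *)
    have e2 : (2 ^ p)%N%:R <= (2 ^ (p * k).-1)%N%:R :> R.
      rewrite ler_nat leq_exp2l//.
      have : (p * 2 <= p * k)%N by rewrite leq_mul2l (card_arcs G) orbT.
      by move: p0; clear; lia.
    have e3 : 0 <= (2 ^ (p * k).-1)%N%:R :> R by [].
    apply: ler_pM.
    * by apply: mulr_ge0; [lra | exact: expR_ge0].
    * by rewrite invr_ge0 ltW.
    * lra.
    * by rewrite lef_pV2 ?posrE// ler_nat ltnW.
  + by move=> T HT; exists p => //=; rewrite p0 pq.
  + by rewrite (le_trans hq).
  + have : 2 * (p%:R * S / q%:R) * 4 <= 2 * (c1 / 8) * 4.
      by rewrite ler_pM2r// ler_pM2l// (le_trans hq).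
    lra.
Unshelve. all: by end_near. Qed.
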